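(* Let $I,J,K$ be spherical subsets of $S$, and let $u\in R(I,J)$ and $v\in R(J,K)$. Then $$P_u^{IJ}P_v^{JK}=\sum_{w\in R(I,K)}c_{u,v^{-1}}^w(I,J,K)\,P_w^{IK}.$$ In particular, the linear map $\theta:\mathscr{A}(I,I)\to\mathbf{1}_I\mathscr{H}\mathbf{1}_I$ determined by $T_w^{II}\mapsto P_w^{II}$ ($w\in R(I,I)$) is an isomorphism of algebras, and $\mathscr{A}(I,J)$ is a left $\mathbf{1}_I\mathscr{H}\mathbf{1}_I$-module and a right $\mathbf{1}_J\mathscr{H}\mathbf{1}_J$-module.
   Context: $(W,S)$ is a Coxeter system with $S$ finite; $W_I=\langle I\rangle$; $I$ spherical means $W_I$ finite; $R(I,J)$ is the set of minimal-length representatives of double cosets $W_IwW_J$. $X$ is a locally finite building of type $(W,S)$ with chamber set $\mathcal{C}$ and Weyl distance $\delta$, regular: each panel of cotype $\{s\}$ lies in exactly $q_s+1$ chambers. $q_w=q_{s_1}\cdots q_{s_k}$ for $w=s_1\cdots s_k$ reduced; $N(K)=\sum_{w\in W_K}q_w$ for spherical $K$. $X_I$ = simplices of cotype $I$; $\mathcal{C}(A)$ = chambers containing $A$; for $A\in X_I$, $B\in X_J$, $\delta(A,B)$ is the element of $R(I,J)$ in the double coset $\delta(\mathcal{C}(A)\times\mathcal{C}(B))$; $F(A,J,w)=\{B\in X_J:\delta(A,B)=w\}$. For $u\in R(I,J)$, $y\in R(K,J)$, $w\in R(I,K)$, $c_{u,y}^w(I,J,K)=|F(A,J,u)\cap F(B,J,y)|$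 for any $A\in X_I$, $B\in X_K$ with $\delta(A,B)=w$ (independent of choice). For $w\in R(I,J)$, $T_w^{IJ}$ sends $f:X_J\to\mathbb{C}$ to $(T_w^{IJ}f)(A)=\sum_{B\in F(A,J,w)}f(B)$, and $\mathscr{A}(I,J)$ is the span of these operators ($\mathscr{A}(I,I)$ is an algebra under composition). $T_w=T_w^{\emptyset\emptyset}$ acts on functions on $\mathcal{C}$ and $\mathscr{H}=\mathscr{A}(\emptyset,\emptyset)$. For spherical $I$, $\mathbf{1}_I=\frac{1}{N(I)}\sum_{w\in W_I}T_w$; for $w\in R(I,J)$, $P_w^{IJ}=\frac{N(I)}{N(I\cap wJw^{-1})}\mathbf{1}_IT_w\mathbf{1}_J$. The module actions of $\mathbf{1}_I\mathscr{H}\mathbf{1}_I$ on $\mathscr{A}(I,J)$ are via the isomorphisms $\mathscr{A}(I,I)\cong\mathbf{1}_I\mathscr{H}\mathbf{1}_I$, $\mathscr{A}(J,J)\cong\mathbf{1}_J\mathscr{H}\mathbf{1}_J$ and composition. *)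

(* Defs.v *)
From HB Require Import structures.
From mathcomp Require Import all_boot all_order all_algebra.
From mathcomp Require Import all_classical reals.
From mathcomp Require Import complex.

Set Implicit Arguments.
Unset Strict Implicit.
Unset Printing Implicit Defensive.

Import GRing.Theory.
Local Open Scope classical_set_scope.
Local Open Scope ring_scope.
Local Open Scope card_scope.

Definition has_order (G : groupType) (x : G) (m : nat) : Prop :=
  [/\ (0 < m)%N, (x ^+ m)%g = 1%g
    & forall k, (0 < k < m)%N -> (x ^+ k)%g <> 1%g].

Definition word_prod (G : groupType) (S : Type) (f : S -> G) (ws : seq S) : G :=
  (\prod_(s <- ws) f s)%g.

(* The last field says that the relations (st)^m(s,t) = 1, with m(s,t) the
   order of st, for all s, t such that this order is finite, present W. *)
Record is_coxeter (W : groupType) (S : finType) (gen : S -> W) : Prop :=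
  IsCoxeter {
    gen_inj : injective gen;
    gen_order2 : forall s, has_order (gen s) 2;
    gen_generate : forall w, exists ws, word_prod gen ws = w;
    gen_present : forall (G : groupType) (f : S -> G),
      (forall s t m, has_order (gen s * gen t)%g m -> ((f s * f t) ^+ m)%g = 1%g) ->
      exists phi : {multiplicative W -> G}, forall s, phi (gen s) = f s
  }.

Record coxeterSystem := CoxeterSystem {
  cox_group :> groupType;
  cox_index : finType;
  cox_gen : cox_index -> cox_group;
  coxeterP : is_coxeter cox_gen
}.

Section Coxeter.
Variable W : coxeterSystem.
Local Notation S := (cox_index W).
Local Notation gen := (@cox_gen W).

Definition reduced_word (ws : seq S) : Prop :=
  forall ws', word_prod gen ws' = word_prod gen ws -> (size ws <= size ws')%N.

Definition redword (w : W) : seq S :=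
  xget [::] [set ws | reduced_word ws /\ word_prod gen ws = w].

Definition len (w : W) : nat := size (redword w).

(* No inverses are needed since the generators are involutions. *)
Definition parabolic (I : {set S}) : set W :=
  [set w | exists2 ws : seq S, {subset ws <= I} & word_prod gen ws = w].

Definition spherical (I : {set S}) : Prop := finite_set (parabolic I).

Definition minrep (I J : {set S}) : set W :=
  [set w | forall a b, parabolic I a -> parabolic J b ->
             (len w <= len (a * w * b)%g)%N].

Definition conj_cap (I : {set S}) (w : W) (J : {set S}) : {set S} :=
  finset (fun s => (s \in I) &&
    `[< exists2 t, t \in J & gen s = (w * gen t * w^-1)%g >]).

Definition qword (q : S -> nat) (w : W) : nat := (\prod_(s <- redword w) q s)%N.

Definition poincare (q : S -> nat) (I : {set S}) : nat :=
  \sum_(w \in parabolic I) qword q w.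

End Coxeter.

Record is_building (W : coxeterSystem) (C : Type) (delta : C -> C -> W) : Prop :=
  IsBuilding {
    building_nonempty : exists c : C, True;
    wdist_eq1 : forall c d, delta c d = 1%g <-> c = d;
    wdist_step : forall c d c' s, delta c' c = cox_gen s ->
      delta c' d = (cox_gen s * delta c d)%g \/ delta c' d = delta c d;
    wdist_step_up : forall c d c' s, delta c' c = cox_gen s ->
      len (cox_gen s * delta c d)%g = (len (delta c d)).+1 ->
      delta c' d = (cox_gen s * delta c d)%g;
    wdist_adj : forall c d s, exists2 c', delta c' c = cox_gen s
      & delta c' d = (cox_gen s * delta c d)%g
  }.

Record building (W : coxeterSystem) := Building {
  chamber : choiceType;
  wdist : chamber -> chamber -> W;
  buildingP : is_building wdist
}.

Section Simplices.
Variables (W : coxeterSystem) (X : building W).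
Local Notation S := (cox_index W).

(* A simplex of cotype I is identified with the set of chambers containing it,
   that is, with a residue of type I. *)
Definition residues (I : {set S}) : set (set (chamber X)) :=
  [set A | exists c, A = [set d | parabolic I (wdist c d)]].

Definition simplex (I : {set S}) : choiceType := residues I.

Definition chambers (I : {set S}) (A : simplex I) : set (chamber X) := val A.

Definition regular (q : S -> nat) : Prop :=
  forall (s : S) (A : simplex (finset.set1 s)), chambers A #= `I_(q s).+1.

Definition sdist (I J : {set S}) (A : simplex I) (B : simplex J) : W :=
  xget 1%g (minrep I J `&`
            [set wdist a b | a in chambers A & b in chambers B]).

Definition sphere (I J : {set S}) (A : simplex I) (w : W) : set (simplex J) :=
  [set B | sdist A B = w].

(* The common cardinality of the sets F(A,J,u) `&` F(B,J,y), for all A in X_I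
   and B in X_K with delta(A,B) = w. *)
Definition cnum (I J K : {set S}) (u y w : W) : nat :=
  xget 0%N [set n | forall (A : simplex I) (B : simplex K), sdist A B = w ->
              sphere (J := J) A u `&` sphere (J := J) B y #= `I_n].

End Simplices.

Section LinearAlgebra.
Variable F : fieldType.

Definition subspace (V : lmodType F) (M : set V) : Prop :=
  M 0 /\ forall (a : F) x y, M x -> M y -> M (a *: x + y).

Definition lin_span (V : lmodType F) (E : set V) : set V :=
  [set x | exists (n : nat) (a : 'I_n -> F) (e : 'I_n -> V),
     (forall i, E (e i)) /\ x = \sum_i a i *: e i].

Definition linear_on (V V' : lmodType F) (M : set V) (f : V -> V') : Prop :=
  forall (a : F) x y, M x -> M y -> f (a *: x + y) = a *: f x + f y.

Record is_algebra (V : lmodType F) (mul : V -> V -> V) (e : V) (A : set V) :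
  Prop := IsAlgebra {
    alg_subspace : subspace A;
    alg_one : A e;
    alg_mul : forall x y, A x -> A y -> A (mul x y);
    alg_mulA : forall x y z, A x -> A y -> A z ->
      mul x (mul y z) = mul (mul x y) z;
    alg_mul1 : forall x, A x -> mul e x = x /\ mul x e = x;
    alg_linl : forall y, A y -> linear_on A (fun x => mul x y);
    alg_linr : forall x, A x -> linear_on A (mul x)
  }.

Record is_algebra_iso (V V' : lmodType F)
    (mul : V -> V -> V) (e : V) (A : set V)
    (mul' : V' -> V' -> V') (e' : V') (A' : set V') (f : V -> V') : Prop :=
  IsAlgebraIso {
    iso_dom : is_algebra mul e A;
    iso_codom : is_algebra mul' e' A';
    iso_lin : linear_on A f;
    iso_bij : set_bij A A' f;
    iso_mul : forall x y, A x -> A y -> f (mul x y) = mul' (f x) (f y);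
    iso_one : f e = e'
  }.

Record is_left_module (V U : lmodType F) (mul : V -> V -> V) (e : V)
    (A : set V) (M : set U) (act : V -> U -> U) : Prop := IsLeftModule {
    lmod_subspace : subspace M;
    lmod_act : forall x m, A x -> M m -> M (act x m);
    lmod_linl : forall m, M m -> linear_on A (fun x => act x m);
    lmod_linr : forall x, A x -> linear_on M (act x);
    lmod_mul : forall x y m, A x -> A y -> M m ->
      act (mul x y) m = act x (act y m);
    lmod_one : forall m, M m -> act e m = m
  }.

Definition is_right_module (V U : lmodType F) (mul : V -> V -> V) (e : V)
    (A : set V) (M : set U) (act : U -> V -> U) : Prop :=
  is_left_module (fun x y => mul y x) e A M (fun x m => act m x).

End LinearAlgebra.

Section Operators.
Variables (R : realType) (W : coxeterSystem) (X : building W).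
Local Notation S := (cox_index W).

Definition op (I J : {set S}) : lmodType R[i] :=
  (simplex X J -> R[i]^o) -> (simplex X I -> R[i]^o).

Definition comp_op (I J K : {set S}) (a : op I J) (b : op J K) : op I K :=
  fun f => a (b f).

Definition id_op (I : {set S}) : op I I := fun f => f.
Arguments id_op : clear implicits.

Definition Tav (I J : {set S}) (w : W) : op I J :=
  fun f A => \sum_(B \in sphere A w) f B.
Arguments Tav : clear implicits.

Definition Aspace (I J : {set S}) : set (op I J) :=
  lin_span [set Tav I J w | w in minrep I J].
Arguments Aspace : clear implicits.

(* Simplices of empty cotype are the (singletons of) chambers. *)
Definition hop : lmodType R[i] := op (finset.set0 : {set S}) (finset.set0 : {set S}).

Definition Thecke (w : W) : hop := Tav finset.set0 finset.set0 w.

Definition hecke : set hop := Aspace finset.set0 finset.set0.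

Definition mul_hop (a b : hop) : hop := comp_op a b.

Variable q : S -> nat.

Definition idem (I : {set S}) : hop :=
  ((poincare q I)%:R : R[i])^-1 *: \sum_(w \in parabolic I) Thecke w.

Definition Pop (I J : {set S}) (w : W) : hop :=
  ((poincare q I)%:R / (poincare q (conj_cap I w J))%:R : R[i]) *:
    mul_hop (mul_hop (idem I) (Thecke w)) (idem J).

Definition corner (I : {set S}) : set hop :=
  [set mul_hop (mul_hop (idem I) h) (idem I) | h in hecke].

End Operators.

Arguments op R {W} X I J.
Arguments hop R {W} X.
Arguments comp_op {R W X I J K} a b.
Arguments mul_hop {R W X} a b.
Arguments id_op R {W} X I.
Arguments Tav R {W} X I J w.
Arguments Aspace R {W} X I J.
Arguments Thecke R {W} X w.
Arguments hecke R {W} X.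
Arguments idem R {W} X q I.
Arguments Pop R {W} X q I J w.
Arguments corner R {W} X q I.

(* Main.v *)
(* Averaging over the chambers of a simplex of cotype [I], and pulling back to
   chambers, give maps [defl I] and [infl I] between functions on chambers and
   functions on simplices of cotype [I], with [defl I \o infl I = id] and [infl I \o defl I = idem I].
   Counting the pairs of chambers [(a, b)] in [A * B] at distance [w], where [w]
   is the minimal element [sdist A B], gives
   [Pop I J w = infl I \o Tav I J w \o defl J]. Hence the operators [Pop]
   multiply as the operators [Tav] do, and [x |-> infl I \o x \o defl I] is an
   isomorphism onto the corner. The structure constants are read off by applying
   [Tav u \o Tav v] to the indicator function of a simplex: since this product
   lies in the span of the [Tav w], its value depends on the distance only, which
   also shows that the cardinality defining [cnum] is well defined. *)
Require Import Defs.
From HB Require Import structures.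
From mathcomp Require Import all_boot all_order all_algebra.
From mathcomp Require Import all_classical reals.
From mathcomp Require Import complex ring zify.

Set Implicit Arguments.
Unset Strict Implicit.
Unset Printing Implicit Defensive.

Import GRing.Theory.
Local Open Scope classical_set_scope.
Local Open Scope ring_scope.
Local Open Scope card_scope.

(** * Exchange condition and minimal double coset representatives *)

(** That the structure constants do not depend on the pair of simplices is obtained algebraically. A
    composite [comp_op x y] equals [defl I \o h \o infl K], where [h] is the product of the
    operators that [infl] and [defl] attach to [x] and [y]. So it suffices that [hecke] is closed
    under products and that compressing any [Thecke w], minimal or not, lands in [Aspace I K]. The
    first rests on the quadratic relation, the second on a length-additive factorization $w=amb$
    with $m$ minimal, in which $T_a$ and $T_b$ act as scalars next to the averages. The scalar in
    $P_w^{IJ}$ inverts the ratio $N(I\cap wJw^{-1})/N(I)$ with which a simplex of $F(A,J,w)$ is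
    reached from the chambers of $A$. Its value depends on Kilmoyer's theorem, hence on the exchange
    condition, which must be extracted from the presentation of $W$. As $W$ may be infinite, every
    sum needs a finite support: spheres around spherical residues are finite, and the sum over
    $R(I,K)$ is finite because the product is a finite combination of operators. *)

Section Twisted.
Variable G : groupType.
Local Open Scope group_scope.

(* The semidirect product of [G -> Z/2] by [G] acting by conjugation. *)
Definition twisted : Type := ((G -> bool) * G)%type.

HB.instance Definition _ := gen_eqMixin twisted.
HB.instance Definition _ := gen_choiceMixin twisted.

Definition tw_mul (x y : twisted) : twisted :=
  (fun t => x.1 t (+) y.1 (t ^ x.2), x.2 * y.2).
Definition tw_one : twisted := (fun=> false, 1).
Definition tw_inv (x : twisted) : twisted := (fun t => x.1 (t ^ x.2^-1), x.2^-1).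

Lemma tw_mulA : associative tw_mul.
Proof.
move=> x y z; congr pair; last exact: mulgA.
by apply/funext => t /=; rewrite addbA conjgM.
Qed.

Lemma tw_mul1 : left_id tw_one tw_mul.
Proof.
move=> [f x]; congr pair; last exact: mul1g.
by apply/funext => t /=; rewrite conjg1.
Qed.

Lemma tw_mul1r : right_id tw_one tw_mul.
Proof.
move=> [f x]; congr pair; last exact: mulg1.
by apply/funext => t /=; rewrite addbF.
Qed.

Lemma tw_mulV : left_inverse tw_one tw_inv tw_mul.
Proof.
move=> [f x]; congr pair; last exact: mulVg.
by apply/funext => t /=; rewrite addbb.
Qed.

Lemma tw_mulrV : right_inverse tw_one tw_inv tw_mul.
Proof.
move=> [f x]; congr pair; last exact: mulgV.
by apply/funext => t /=; rewrite -conjgM mulgV conjg1 addbb.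
Qed.

HB.instance Definition _ :=
  isGroup.Build twisted tw_mulA tw_mul1 tw_mul1r tw_mulV tw_mulrV.

Lemma tw_exp (x : twisted) m :
  x ^+ m = (fun t => \big[addb/false]_(k < m) x.1 (t ^ (x.2 ^+ k)), x.2 ^+ m).
Proof.
elim: m => [|m IH].
  rewrite !expg0; congr pair.
  by apply/funext => t; rewrite big_ord0.
rewrite !expgS IH; congr pair.
apply/funext => t /=; rewrite big_ord_recl /= expg0 conjg1; congr addb.
by apply: eq_bigr => k _; rewrite /bump /= add1n expgS conjgM.
Qed.

End Twisted.

Section Words.
Variables (G : groupType) (S : Type) (f : S -> G).
Local Open Scope group_scope.

Lemma word_prod_nil : word_prod f [::] = 1.
Proof. exact: big_nil. Qed.

Lemma word_prod_cons s ws : word_prod f (s :: ws) = f s * word_prod f ws.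
Proof. exact: big_cons. Qed.

Lemma word_prod_cat ws ws' :
  word_prod f (ws ++ ws') = word_prod f ws * word_prod f ws'.
Proof. exact: big_cat. Qed.

End Words.

(** * Length function and exchange condition *)

Section Coxeter.
Variable W : coxeterSystem.
Local Notation S := (cox_index W).
Local Notation gen := (@cox_gen W).
Local Open Scope group_scope.

Lemma gen_mulK s : gen s * gen s = 1.
Proof. by have [_ + _] := gen_order2 (coxeterP W) s; rewrite expg2. Qed.

Lemma gen_inv s : (gen s)^-1 = gen s.
Proof. by apply: mulg1_eq; exact: gen_mulK. Qed.

Lemma gen_neq1 s : gen s <> 1.
Proof. by have [_ _ /(_ 1%N erefl)] := gen_order2 (coxeterP W) s. Qed.

Lemma gen_mulKl s w : gen s * (gen s * w) = w.
Proof. by rewrite mulgA gen_mulK mul1g. Qed.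

(** Conjugation by [gen s] inverts the product of the two generators. *)
Lemma dihedral_conj s t k :
  (gen s * gen t) ^+ k * gen s * (gen s * gen t) ^+ k = gen s.
Proof.
elim: k => [|k IH]; first by rewrite expg0 mul1g mulg1.
rewrite {1}expgSr expgS -!mulgA.
rewrite (mulgA (gen s) (gen s)) gen_mulK mul1g (mulgA (gen t) (gen t)) gen_mulK.
by rewrite mul1g mulgA IH.
Qed.

Lemma big_addb_pairs (g : nat -> bool) m :
  \big[addb/false]_(k < m) (g k.*2 (+) g k.*2.+1) =
  \big[addb/false]_(k < m.*2) g k.
Proof.
elim: m => [|m IH]; first by rewrite !big_ord0.
by rewrite doubleS !big_ord_recr /= IH addbA.
Qed.

Definition tw_gen (s : S) : twisted W := (fun t => t == gen s, gen s).

(** With $c=st$, the first component at $r$ is the parity of the number of $j<2m$ with $r=c^js$. As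
    $c^m=1$, the exponents $j$ and $j+m$ give the same reflection, so this number is even. *)
Lemma tw_gen_rel s t m : has_order (gen s * gen t) m ->
  (tw_gen s * tw_gen t) ^+ m = 1.
Proof.
move=> [m0 cm _]; rewrite tw_exp; congr pair => //; apply/funext => r /=.
set c := gen s * gen t in cm *.
have conjE k : gen s * (c ^+ k)^-1 = c ^+ k * gen s.
  by apply: (mulIg (c ^+ k)); rewrite mulgVK dihedral_conj.
have conj_eq (y z x : W) : (y ^ x == z) = (y == x * (z * x^-1)).
  by rewrite (can2_eq (conjgK x) (conjgKV x)) conjgE invgK.
(* The factors [tw_gen s] account for the even exponents, the factors [tw_gen t] for the odd
   ones. *)
have E1 k : (r ^ (c ^+ k) == gen s) = (r == c ^+ k.*2 * gen s).
  by rewrite conj_eq conjE -addnn expgnDr mulgA.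
have E2 k : ((r ^ (c ^+ k)) ^ gen s == gen t) = (r == c ^+ k.*2.+1 * gen s).
  rewrite !conj_eq gen_inv (mulgA (gen s)) -/c -(mulgA c) conjE.
  by rewrite -addnn -addnS expgnDr expgS !mulgA.
pose g j := r == c ^+ j * gen s.
transitivity (\big[addb/false]_(k < m.*2) g k).
  by rewrite -big_addb_pairs; apply: eq_bigr => k _; rewrite E1 E2.
rewrite -addnn big_split_ord /= -[RHS](addbb (\big[addb/false]_(k < m) g k)).
congr addb.
by apply: eq_bigr => k _; rewrite /g /= expgnDr cm mul1g.
Qed.

(* [n w t] is the parity of the number of times the reflection [t] occurs among
   [s_1 .. s_(i-1) s_i s_(i-1) .. s_1], for any word [s_1 .. s_k] of [w]. *)
Lemma reflection_cocycle : exists n : W -> W -> bool,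
  (forall s t, n (gen s) t = (t == gen s)) /\
  (forall u v t, n (u * v) t = n u t (+) n v (t ^ u)).
Proof.
have [phi phiE] := gen_present (coxeterP W) tw_gen_rel.
have phiM u v : phi (u * v) = phi u * phi v by exact: gmulfM.
have phi2 w : (phi w).2 = w.
  have [ws <-] := gen_generate (coxeterP W) w.
  elim: ws => [|s ws IH]; last by rewrite word_prod_cons phiM phiE /= IH.
  rewrite word_prod_nil.
  have /(congr1 snd) := phiM 1 1; rewrite mulg1 /= => E.
  by apply: (mulgI (phi 1).2); rewrite mulg1 -E.
exists (fun w => (phi w).1); split=> [s t|u v t]; first by rewrite phiE.
by rewrite phiM /= phi2.
Qed.

Lemma redword_spec w : reduced_word (redword w) /\ word_prod gen (redword w) = w.
Proof.
rewrite /redword; case: xgetP => [ws _ //|none]; exfalso.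
have [ws wsE] := gen_generate (coxeterP W) w.
pose P n := `[< exists2 ws : seq S, word_prod gen ws = w & size ws = n >].
have exP : exists n, P n by exists (size ws); apply/asboolP; exists ws.
case: (ex_minnP exP) => n /asboolP[ws' E1 E2] min.
apply: (none ws'); split => // ws'' E; rewrite E2; apply: min.
by apply/asboolP; exists ws''; rewrite // E.
Qed.

Lemma redwordE w : word_prod gen (redword w) = w.
Proof. by have [] := redword_spec w. Qed.

Lemma len_le ws : (len (word_prod gen ws) <= size ws)%N.
Proof. by have [+ E] := redword_spec (word_prod gen ws); apply; rewrite E. Qed.

Lemma len1 : @len W 1 = 0%N.
Proof. by apply/eqP; rewrite -leqn0 -(word_prod_nil gen); exact: len_le. Qed.

Lemma len_eq0 (w : W) : len w = 0%N -> w = 1.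
Proof.
by move=> /size0nil E; rewrite -[LHS]redwordE E word_prod_nil.
Qed.

Lemma len_mul (u v : W) : (len (u * v) <= len u + len v)%N.
Proof.
rewrite -{1}[u]redwordE -{1}[v]redwordE -word_prod_cat.
by rewrite (leq_trans (len_le _)) // size_cat.
Qed.

Lemma word_prod_rev ws : word_prod gen (rev ws) = (word_prod gen ws)^-1.
Proof.
elim: ws => [|s ws IH]; first by rewrite word_prod_nil invg1.
by rewrite rev_cons -cats1 word_prod_cat !word_prod_cons word_prod_nil mulg1
           invgM gen_inv IH.
Qed.

Lemma lenV (w : W) : len w^-1 = len w.
Proof.
suff H (u : W) : (len u^-1 <= len u)%N.
  by apply/eqP; rewrite eqn_leq H -{1}[w]invgK H.
by rewrite -{1}[u]redwordE -word_prod_rev (leq_trans (len_le _)) // size_rev.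
Qed.

Lemma len_gen s : len (gen s) = 1%N.
Proof.
apply/eqP; rewrite eqn_leq; apply/andP; split.
  by rewrite -[gen s]mulg1 -(word_prod_nil gen) -word_prod_cons; exact: len_le.
by rewrite lt0n; apply/eqP => /len_eq0 /gen_neq1.
Qed.

Lemma exchange s ws :
  (len (gen s * word_prod gen ws) <= len (word_prod gen ws))%N ->
  exists ws', [/\ subseq ws' ws, (size ws').+1 = size ws
    & gen s * word_prod gen ws = word_prod gen ws'].
Proof.
have [n [n_gen n_mul]] := reflection_cocycle.
have n1 t : n 1 t = false.
  by have := n_mul 1 1 t; rewrite mulg1 conjg1 addbb.
have exch : forall us t, n (word_prod gen us) t ->
    exists us', [/\ subseq us' us, (size us').+1 = size us
      & t * word_prod gen us = word_prod gen us'].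
  elim=> [|r us IH] t; first by rewrite word_prod_nil n1.
  rewrite word_prod_cons n_mul n_gen.
  have [-> _|tr /=] := eqVneq t (gen r).
    by exists us; rewrite subseq_cons gen_mulKl.
  move=> /IH [us' [sub sz E]]; exists (r :: us'); split.
  - by rewrite /= eqxx.
  - by rewrite /= sz.
  - by rewrite word_prod_cons -E conjgE gen_inv !mulgA gen_mulK mul1g.
move=> le; have [|nw] := boolP (n (word_prod gen ws) (gen s)).
  exact: exch.
(* An even value for [w] is an odd value for [gen s * w]. Deleting a letter from a reduced word of
   [gen s * w] then makes [w] strictly shorter than [gen s * w]. *)
exfalso.
set w := word_prod gen ws in le nw.
have : n (word_prod gen (redword (gen s * w))) (gen s).
  by rewrite redwordE n_mul n_gen eqxx conjgE gen_inv gen_mulKl (negbTE nw).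
move=> /exch [us [_ sz E]].
move: E; rewrite redwordE gen_mulKl => E.
by have := len_le us; rewrite -E leqNgt (leq_trans _ le) // /len -sz.
Qed.

(** Equal lengths are excluded by [exchange]: when the length does not grow, a letter of a reduced
    word of [w] disappears. *)
Lemma len_gen_mul s w :
  len (gen s * w) = (len w).+1 \/ len w = (len (gen s * w)).+1.
Proof.
have le u : (len (gen s * u) <= (len u).+1)%N.
  by rewrite (leq_trans (len_mul _ _)) // len_gen.
have [lt|] := ltnP (len w) (len (gen s * w)).
  by left; apply/eqP; rewrite eqn_leq le lt.
rewrite -{1 2}[w]redwordE => /exchange[ws [_ sz]]; rewrite redwordE => E.
right; apply/eqP; rewrite eqn_leq -{1}[w](gen_mulKl s) le /=.
by rewrite E /len -sz ltnS; exact: len_le.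
Qed.

(** Deletion property, by repeated exchange. Passing to a subword keeps the letters in a prescribed
    subset of [S], which is how reduced words stay inside parabolic subgroups. *)
Lemma reduced_subword ws : exists ws',
  [/\ subseq ws' ws, word_prod gen ws' = word_prod gen ws
    & size ws' = len (word_prod gen ws)].
Proof.
elim: ws => [|s ws [ws' [sub E sz]]]; first by exists [::]; rewrite word_prod_nil len1.
rewrite !word_prod_cons.
have [lt|le] := ltnP (len (word_prod gen ws)) (len (gen s * word_prod gen ws)).
  exists (s :: ws'); rewrite /= eqxx word_prod_cons E sz; split=> //.
  apply/eqP; rewrite eqn_leq lt (leq_trans (len_mul _ _)) //.
  by rewrite len_gen.
rewrite -E in le *.
have [ws'' [sub' sz' E']] := exchange le.
exists ws''; split.
- by rewrite (subseq_trans sub') // (subseq_trans sub) // subseq_cons.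
- by rewrite E'.
- apply/eqP; rewrite eqn_leq {2}E' len_le andbT -ltnS sz' sz -E.
  rewrite -{1}(gen_mulKl s (word_prod gen ws')).
  by rewrite (leq_trans (len_mul _ _)) // len_gen.
Qed.

Lemma subseq_catE (T : eqType) (r a b : seq T) : subseq r (a ++ b) ->
  exists a' b', [/\ r = a' ++ b', subseq a' a & subseq b' b].
Proof.
move=> /subseqP[m sm ->].
exists (mask (take (size a) m) a), (mask (drop (size a) m) b).
rewrite !mask_subseq -mask_cat ?cat_take_drop //.
by rewrite size_take sm size_cat; case: ltngtP; lia.
Qed.

(** * Parabolic subgroups and their double cosets *)

Section Parabolic.
Variable I : {set S}.

Lemma par1 : parabolic I (1 : W).
Proof. by exists [::]; rewrite ?word_prod_nil. Qed.

Lemma parM (u v : W) : parabolic I u -> parabolic I v -> parabolic I (u * v).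
Proof.
move=> [a aI <-] [b bI <-]; exists (a ++ b); rewrite ?word_prod_cat //.
by move=> s; rewrite mem_cat => /orP[/aI|/bI].
Qed.

Lemma parV (u : W) : parabolic I u -> parabolic I u^-1.
Proof.
move=> [a aI <-]; exists (rev a); rewrite ?word_prod_rev //.
by move=> s; rewrite mem_rev => /aI.
Qed.

Lemma par_gen s : s \in I -> parabolic I (gen s).
Proof.
move=> sI; exists [:: s]; last by rewrite word_prod_cons word_prod_nil mulg1.
by move=> t; rewrite inE => /eqP ->.
Qed.

Lemma par_word ws : {subset ws <= I} -> parabolic I (word_prod gen ws).
Proof. by exists ws. Qed.

Lemma par_reduced (u : W) : parabolic I u -> exists ws : seq S,
  [/\ {subset ws <= I}, word_prod gen ws = u & size ws = len u].
Proof.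
move=> [ws wsI <-]; have [ws' [sub E sz]] := reduced_subword ws.
by exists ws'; split=> // s /(mem_subseq sub) /wsI.
Qed.

End Parabolic.

Lemma par_sub (I J : {set S}) (u : W) : I \subset J -> parabolic I u -> parabolic J u.
Proof. by move=> /fintype.subsetP IJ [ws wsI <-]; exists ws => // s /wsI /IJ. Qed.

Lemma minrepV I J (w : W) : minrep I J w -> minrep J I w^-1.
Proof.
move=> min a b aJ bI; rewrite lenV.
have := min _ _ (parV bI) (parV aJ).
by rewrite -[X in (_ <= X)%N]lenV !invgM !invgK mulgA.
Qed.

(* By minimality no letter of [m] can be deleted when a word
   [a ++ redword m ++ b] is reduced. *)
Lemma minrep_word I J (m : W) (a b : seq S) :
  minrep I J m -> {subset a <= I} -> {subset b <= J} ->
  exists a' b', [/\ subseq a' a, subseq b' b,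
    word_prod gen a * m * word_prod gen b = word_prod gen a' * m * word_prod gen b'
    & len (word_prod gen a * m * word_prod gen b) = (size a' + len m + size b')%N].
Proof.
move=> min aI bJ; set x := (X in len X).
have [r [sub E sz]] := reduced_subword (a ++ redword m ++ b).
move: E sz; rewrite !word_prod_cat redwordE [in RHS]mulgA -/x => E sz.
have [a' [r' [rE sa sr]]] := subseq_catE sub.
have [m' [b' [r'E sm sb]]] := subseq_catE sr.
have a'I : {subset a' <= I} by move=> s /(mem_subseq sa) /aI.
have b'J : {subset b' <= J} by move=> s /(mem_subseq sb) /bJ.
have m'E : m' = redword m.
  apply/eqP; rewrite -(size_subseq_leqif sm) eqn_leq size_subseq //=.
  apply: leq_trans (len_le m').
  have -> : word_prod gen m' =
    (word_prod gen a')^-1 * word_prod gen a * m *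
      (word_prod gen b * (word_prod gen b')^-1).
    move: E; rewrite rE r'E !word_prod_cat /x => E.
    apply: (mulgI (word_prod gen a')); apply: (mulIg (word_prod gen b')).
    by rewrite -[in LHS]mulgA E !mulgA mulgV mul1g mulgVK.
  by apply: min; apply: parM => //; first apply: parV; try exact: par_word;
     apply: parV; exact: par_word.
exists a', b'; split => //.
  by rewrite -/x -E rE r'E m'E !word_prod_cat redwordE mulgA.
by rewrite mulgA in sz; rewrite -sz rE r'E m'E !size_cat addnA.
Qed.

Lemma minrep_factor I J (m a b : W) :
  minrep I J m -> parabolic I a -> parabolic J b ->
  exists a' b', [/\ parabolic I a', parabolic J b', a * m * b = a' * m * b'
    & len (a * m * b) = (len a' + len m + len b')%N].
Proof.
move=> min [wa wI <-] [wb wJ <-].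
have [a' [b' [sa sb E lenE]]] := minrep_word min wI wJ.
exists (word_prod gen a'), (word_prod gen b'); split => //.
- by apply: par_word => s /(mem_subseq sa) /wI.
- by apply: par_word => s /(mem_subseq sb) /wJ.
apply/eqP; rewrite eqn_leq; apply/andP; split.
  by rewrite E (leq_trans (len_mul _ _)) // leq_add2r len_mul.
by rewrite lenE !leq_add ?len_le.
Qed.

(** With an empty right factor, cancelling $m$ shows that the subword $a'$ still represents $a$, so
    no length is lost. *)
Lemma minrep_len_l I J (m a : W) : minrep I J m -> parabolic I a ->
  len (a * m) = (len a + len m)%N.
Proof.
move=> min aI; have [wa [wI <- wsz]] := par_reduced aI.
have nilJ : {subset [::] <= J} by [].
have [a' [b' [sa]]] := minrep_word min wI nilJ.
rewrite subseq0 => /eqP -> /=; rewrite word_prod_nil !mulg1 addn0 => /mulIg E lenE.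
apply/eqP; rewrite eqn_leq len_mul /= lenE leq_add2r.
by rewrite E len_le.
Qed.

Lemma minrep_len_r I J (m b : W) : minrep I J m -> parabolic J b ->
  len (m * b) = (len m + len b)%N.
Proof.
move=> /minrepV min /parV bJ.
by rewrite -lenV invgM (minrep_len_l min bJ) !lenV addnC.
Qed.

(** Once $m'=a'mb'$ with additive lengths, minimality of $m'$ forces $a'$ and $b'$ to have length
    zero. *)
Lemma minrep_uniq I J (m m' a b : W) : minrep I J m -> minrep I J m' ->
  parabolic I a -> parabolic J b -> m' = a * m * b -> m' = m.
Proof.
move=> min min' aI bJ E.
have [a' [b' [aI' bJ' E' lenE]]] := minrep_factor min aI bJ.
have := min' _ _ (parV aI') (parV bJ'); rewrite {2}E E' !mulgA mulVg mul1g mulgK.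
rewrite [in len m']E lenE => le.
have /len_eq0 a1 : len a' = 0%N by move: le; case: (len a') => //; lia.
have /len_eq0 b1 : len b' = 0%N by move: le; case: (len b') => //; lia.
by rewrite E E' a1 b1 mul1g mulg1.
Qed.

Lemma minrep_exists I J (w : W) : exists a m b,
  [/\ parabolic I a, minrep I J m, parabolic J b & w = a * m * b].
Proof.
pose P n := `[< exists a b, [/\ parabolic I a, parabolic J b & len (a * w * b) = n] >].
have exP : exists n, P n.
  by exists (len (1 * w * 1)); apply/asboolP; exists 1, 1; split => //; exact: par1.
case: (ex_minnP exP) => n /asboolP[a [b [aI bJ E]]] min.
exists a^-1, (a * w * b), b^-1; split; try exact: parV.
- move=> c d cI dJ; rewrite E; apply: min; apply/asboolP.
  by exists (c * a), (b * d); split; rewrite ?mulgA //; exact: parM.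
- by rewrite !mulgA mulVg mul1g mulgK.
Qed.

Lemma minrep_decomp I J (w : W) : exists a m b,
  [/\ parabolic I a, minrep I J m, parabolic J b, w = a * m * b
    & len w = (len a + len m + len b)%N].
Proof.
have [a [m [b [aI min bJ ->]]]] := minrep_exists I J w.
have [a' [b' [aI' bJ' E lenE]]] := minrep_factor min aI bJ.
by exists a', m, b'.
Qed.

(** Each generator of the intersection moves across [w] to a generator in [J]. The converse is
    [minrep_conj_cap]. *)
Lemma par_conj_cap I J (w x : W) : parabolic (conj_cap I w J) x ->
  exists2 y, parabolic J y & x * w = w * y.
Proof.
move=> [ws wsK <-]; elim: ws wsK => [_|s ws IH wsK].
  by exists 1; [exact: par1|rewrite word_prod_nil mul1g mulg1].
have [y yJ E] : exists2 y, parabolic J y & word_prod gen ws * w = w * y.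
  by apply: IH => t tws; apply: wsK; rewrite inE tws orbT.
have := wsK s (mem_head _ _); rewrite inE => /andP[_ /asboolP[t tJ sE]].
exists (gen t * y); first by apply: parM => //; exact: par_gen.
by rewrite word_prod_cons -mulgA E sE !mulgA mulgVK.
Qed.

Lemma conj_cap_sub I J (w : W) : conj_cap I w J \subset I.
Proof. by apply/fintype.subsetP => s; rewrite inE => /andP[]. Qed.

(* Kilmoyer: [W_I] meets [w W_J w^-1] in a standard parabolic subgroup. *)
Lemma minrep_conj_cap I J (w x y : W) : minrep I J w ->
  parabolic I x -> parabolic J y -> x * w = w * y ->
  parabolic (conj_cap I w J) x.
Proof.
move=> min /par_reduced[ws [wsI <- sz]].
elim: ws wsI sz y => [|s ws IH] wsI sz y yJ E.
  by rewrite word_prod_nil; exact: par1.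
rewrite word_prod_cons in sz E *.
set x1 := word_prod gen ws in IH sz E *.
have sI : s \in I by apply: wsI; rewrite mem_head.
have wsI1 : {subset ws <= I} by move=> t tws; apply: wsI; rewrite inE tws orbT.
have x1I : parabolic I x1 by exact: par_word.
have lx1 : size ws = len x1.
  apply/eqP; rewrite eqn_leq len_le andbT -ltnS.
  by rewrite [X in (X <= _)%N]sz (leq_trans (len_mul _ _)) // len_gen.
have [wy [wyJ yE wysz]] := par_reduced yJ.
(* The word represents $wy=xw$. Lengths add in $xw$ and in $x_1w$, so [gen s] shortens it and
   [exchange] applies. *)
have lt : (len (gen s * word_prod gen (redword w ++ wy)) <=
           len (word_prod gen (redword w ++ wy)))%N.
  rewrite word_prod_cat redwordE yE -E -mulgA gen_mulKl mulgA.
  rewrite (minrep_len_l min x1I) (minrep_len_l min); last first.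
    by apply: parM => //; exact: par_gen.
  by rewrite -sz -lx1 leq_add2r.
have [r [sub _]] := exchange lt.
have [r' [wy' [-> sr sy]]] := subseq_catE sub.
have wyJ' : parabolic J (word_prod gen wy').
  by apply: par_word => t /(mem_subseq sy) /wyJ.
rewrite !word_prod_cat redwordE yE => E'.
(* The deleted letter lies in [wy]: a deletion inside [redword w] would give an element of the
   double coset shorter than [w]. *)
have r'E : r' = redword w.
  apply/eqP; rewrite -(size_subseq_leqif sr) eqn_leq size_subseq //=.
  apply: leq_trans (len_le r').
  have -> : word_prod gen r' = gen s * w * (y * (word_prod gen wy')^-1).
    by apply: (mulIg (word_prod gen wy')); rewrite -E' !mulgA mulgVK.
  by apply: min; [exact: par_gen|apply: parM => //; exact: parV].
rewrite r'E redwordE in E'.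
set y2 := word_prod gen wy' in wyJ' E'.
have x1E : x1 * w = w * y2 by rewrite -E' -E -mulgA gen_mulKl.
apply: parM; last exact: IH x1E.
apply: par_gen; rewrite inE sI /=; apply/asboolP.
have zJ : parabolic J (y2 * y^-1) by apply: parM => //; exact: parV.
have sE : gen s * w = w * (y2 * y^-1).
  by apply: (mulIg y); rewrite -mulgA E' !mulgA mulgVK.
(* Lengths add on both sides of [sE], so $w^{-1}sw$ has length one and is a generator from $J$. *)
have : len (w * (y2 * y^-1)) = (len w).+1.
  by rewrite -sE (minrep_len_l min) ?len_gen //; exact: par_gen.
rewrite (minrep_len_r min zJ) -addn1 => /addnI z1.
have [[|t [|t' wz]] [wzJ zE wzsz]] := par_reduced zJ; rewrite z1 in wzsz => //.
exists t; first by apply: wzJ; rewrite mem_head.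
rewrite word_prod_cons word_prod_nil mulg1 in zE.
by rewrite zE -sE mulgK.
Qed.

End Coxeter.

(** * Weyl distance *)

Section Building.
Variables (W : coxeterSystem) (X : building W).
Local Notation S := (cox_index W).
Local Notation gen := (@cox_gen W).
Local Notation C := (chamber X).
Local Notation delta := (@wdist W X).

(** Induction that prepends the letters of a reduced word, so that each step meets the length
    hypothesis of [wdist_step_up]. *)
Lemma len_ind (P : W -> Prop) : P 1%g ->
  (forall s w, len (gen s * w)%g = (len w).+1 -> P w -> P (gen s * w)%g) ->
  forall w, P w.
Proof.
move=> P1 PS w; rewrite -(redwordE w).
have : size (redword w) = len (word_prod gen (redword w)) by rewrite redwordE.
elim: (redword w) => [_|s ws IH]; first by rewrite word_prod_nil.
rewrite word_prod_cons /= => sz.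
have lx : size ws = len (word_prod gen ws).
  apply/eqP; rewrite eqn_leq len_le andbT -ltnS.
  by rewrite [X in (X <= _)%N]sz (leq_trans (len_mul _ _)) // len_gen.
by apply: PS; [rewrite -sz -lx|exact: IH].
Qed.

Lemma delta_refl c : delta c c = 1%g.
Proof. exact/(wdist_eq1 (buildingP X)). Qed.

Lemma delta_eq1 c d : delta c d = 1%g -> c = d.
Proof. by move=> /(wdist_eq1 (buildingP X)). Qed.

Lemma delta_gen_sym c d s : delta c d = gen s -> delta d c = gen s.
Proof.
move=> E; have [] := wdist_step (buildingP X) c E; rewrite delta_refl.
  by move/esym/mulg1_eq; rewrite gen_inv.
by move/esym/delta_eq1 => dc; move: E; rewrite dc delta_refl => /esym /gen_neq1.
Qed.

Lemma delta_up a b c s : delta a b = gen s ->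
  len (gen s * delta b c)%g = (len (delta b c)).+1 ->
  delta a c = (gen s * delta b c)%g.
Proof. by move=> /(wdist_step_up (buildingP X)); apply. Qed.

(** A reduced word of $x$ is followed from $a$: [wdist_adj] strips its letters from the distance to
    $c$, and [delta_up] recomposes the distance from $a$ to $b$. *)
Lemma delta_split x w a c : delta a c = (x * w)%g ->
  exists2 b, delta a b = x & delta b c = w.
Proof.
elim/len_ind: x a => [|s x lx IH] a.
  by rewrite mul1g => E; exists a => //; exact: delta_refl.
rewrite -mulgA => E; have [a' a'a] := wdist_adj (buildingP X) a c s.
rewrite E gen_mulKl => /IH [b a'b bc]; exists b => //.
by rewrite (delta_up (delta_gen_sym a'a)) a'b.
Qed.

Lemma delta_add x w a b c : delta a b = x -> delta b c = w ->
  len (x * w)%g = (len x + len w)%N -> delta a c = (x * w)%g.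
Proof.
elim/len_ind: x a => [|s x lx IH] a.
  by move=> /delta_eq1 -> ->; rewrite mul1g.
rewrite -mulgA => /delta_split[a' aa' a'b] bc; rewrite lx => lE.
have lxw : len (x * w)%g = (len x + len w)%N.
  apply/eqP; rewrite eqn_leq len_mul -ltnS -addSn -lE.
  by rewrite (leq_trans (len_mul _ _)) // len_gen.
have a'c := IH _ a'b bc lxw.
by rewrite (delta_up aa') a'c // lE lxw addSn.
Qed.

Lemma delta_sym c d : delta d c = (delta c d)^-1%g.
Proof.
move: {2 3}(delta c d) (erefl (delta c d)) => w E.
elim/len_ind: w c E => [|s w lw IH] c.
  by move=> /delta_eq1 ->; rewrite delta_refl invg1.
move=> /delta_split[b cb /IH dbw].
rewrite invgM gen_inv; apply: delta_add dbw (delta_gen_sym cb) _.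
by rewrite -{1}[gen s]gen_inv -invgM !lenV lw len_gen addn1.
Qed.

Lemma delta_onto c w : exists d, delta c d = w.
Proof.
elim/len_ind: w c => [|s w lw IH] c; first by exists c; rewrite delta_refl.
have [b cb _] := wdist_adj (buildingP X) c c s.
have [d bd] := IH b; exists d.
by rewrite (delta_up (delta_gen_sym cb)) bd.
Qed.

(** Along a gallery with types in $I$, each adjacency either multiplies the distance to $c$ by its
    letter or leaves it unchanged. *)
Lemma delta_par I a b c : parabolic I (delta a b) ->
  exists2 x, parabolic I x & delta a c = (x * delta b c)%g.
Proof.
move=> [ws wsI]; elim: ws wsI a => [_|s ws IH wsI] a.
  rewrite word_prod_nil => /esym/delta_eq1 ->.
  by exists 1%g; rewrite ?mul1g //; exact: par1.
rewrite word_prod_cons => /esym /delta_split[a' aa' /esym a'b].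
have [|x xI E] := IH _ a' a'b; first by move=> t tws; apply: wsI; rewrite inE tws orbT.
have [->|->] := wdist_step (buildingP X) c aa'; rewrite E.
  exists (gen s * x)%g; last by rewrite mulgA.
  by apply: parM => //; apply/par_gen/wsI; rewrite mem_head.
by exists x.
Qed.

(** * Residues and distances between simplices *)

Section Residues.
Variable I : {set S}.

Lemma par_delta_sym a b : parabolic I (delta a b) -> parabolic I (delta b a).
Proof. by rewrite delta_sym => /parV; rewrite invgK. Qed.

Lemma par_delta_trans a b c : parabolic I (delta a b) ->
  parabolic I (delta b c) -> parabolic I (delta a c).
Proof. by move=> /(@delta_par _ _ _ c)[x xI ->]; exact: parM. Qed.

Lemma residue_subproof (c : C) :
  [set d | parabolic I (delta c d)] \in @residues W X I.
Proof. by apply/mem_set; exists c. Qed.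

Definition res (c : C) : simplex X I :=
  exist (fun A => A \in residues I) _ (residue_subproof c).

Lemma chambers_res c d : chambers (res c) d = parabolic I (delta c d).
Proof. by []. Qed.

Lemma chambers_res_self c : chambers (res c) c.
Proof. by rewrite chambers_res delta_refl; exact: par1. Qed.

Lemma res_eq (A : simplex X I) c : chambers A c -> res c = A.
Proof.
have [a AE] := set_valP A; move=> Ac; apply: val_inj.
rewrite /chambers AE /= in Ac *.
apply/seteqP; split=> d /=; first exact: par_delta_trans.
by apply: par_delta_trans; exact: par_delta_sym.
Qed.

Lemma chambers_delta (A : simplex X I) c d :
  chambers A c -> chambers A d = parabolic I (delta c d).
Proof. by move=> /res_eq <-. Qed.

Lemma chambers_nonempty (A : simplex X I) : exists c, chambers A c.
Proof.
have [a AE] := set_valP A; exists a.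
by rewrite /chambers AE /= delta_refl; exact: par1.
Qed.

Lemma chambersP (A : simplex X I) c : chambers A c <-> res c = A.
Proof. by split => [/res_eq //|<-]; exact: chambers_res_self. Qed.

End Residues.

Section Distances.
Variables (I J : {set S}).
Implicit Types (A : simplex X I) (B : simplex X J).

Lemma delta_double_coset A B a b a' b' : chambers A a -> chambers A a' ->
  chambers B b -> chambers B b' ->
  exists x y, [/\ parabolic I x, parabolic J y &
    delta a' b' = (x * delta a b * y)%g].
Proof.
move=> Aa Aa' Bb Bb'.
have [|x xI E] := @delta_par I a' a b'; first by rewrite -(chambers_delta _ Aa').
have [|y yJ E'] := @delta_par J b' b a; first by rewrite -(chambers_delta _ Bb').
exists x, y^-1%g; split => //; first exact: parV.
by rewrite E delta_sym E' invgM -delta_sym mulgA.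
Qed.

Lemma delta_double_coset_surj A B a b x y w : chambers A a -> chambers B b ->
  parabolic I x -> parabolic J y -> delta a b = (x * w * y)%g ->
  exists a' b', [/\ chambers A a', chambers B b' & delta a' b' = w].
Proof.
move=> Aa Bb xI yJ; rewrite -mulgA => /delta_split[a' aa' /delta_split[b' a'b' b'b]].
exists a', b'; split => //.
  by rewrite (chambers_delta _ Aa) aa'.
by rewrite (chambers_delta _ Bb) delta_sym b'b; exact: parV.
Qed.

(** The minimal element of the double coset is realised by a pair of chambers, so the default value
    in [sdist] is never taken. *)
Lemma sdist_spec A B : minrep I J (sdist A B) /\
  exists a b, [/\ chambers A a, chambers B b & delta a b = sdist A B].
Proof.
rewrite /sdist; case: xgetP => [w _ [min [a Aa [b Bb E]]]|none].
  by split=> //; exists a, b.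
exfalso; have [a Aa] := chambers_nonempty A; have [b Bb] := chambers_nonempty B.
have [x [m [y [xI min yJ E]]]] := minrep_exists I J (delta a b).
have [a' [b' [Aa' Bb' E']]] := delta_double_coset_surj Aa Bb xI yJ E.
by apply: (none m); split => //; exists a' => //; exists b'.
Qed.

Lemma sdist_eq A B a b x y w : chambers A a -> chambers B b ->
  minrep I J w -> parabolic I x -> parabolic J y -> delta a b = (x * w * y)%g ->
  sdist A B = w.
Proof.
move=> Aa Bb min xI yJ E.
have [min' [a' [b' [Aa' Bb' E']]]] := sdist_spec A B.
have [x' [y' [xI' yJ' E'']]] := delta_double_coset Aa Aa' Bb Bb'.
apply: (minrep_uniq min min' (parM xI' xI) (parM yJ yJ')).
by rewrite -E' E'' E !mulgA.
Qed.

Lemma sdist_delta A B a b : chambers A a -> chambers B b ->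
  minrep I J (delta a b) -> sdist A B = delta a b.
Proof.
move=> Aa Bb min; apply: (sdist_eq Aa Bb min (par1 I) (par1 J)).
by rewrite mul1g mulg1.
Qed.

Lemma sdist_onto w : minrep I J w -> exists A B, sdist A B = w.
Proof.
move=> min; have [c _] := building_nonempty (buildingP X).
have [d cd] := delta_onto c w.
exists (res I c), (res J d).
by rewrite -cd in min *; apply: sdist_delta => //; exact: chambers_res_self.
Qed.

End Distances.

Lemma sdistV I J (A : simplex X I) (B : simplex X J) :
  sdist B A = (sdist A B)^-1%g.
Proof.
have [min [a [b [Aa Bb E]]]] := sdist_spec A B.
by rewrite -E -delta_sym; apply: sdist_delta => //; rewrite delta_sym E; exact: minrepV.
Qed.

(** * Finiteness consequences of regularity *)

Section Regular.
Variables (q : S -> nat) (Xq : regular X q).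

Lemma delta_finite c w : finite_set [set d | delta c d = w].
Proof.
elim/len_ind: w c => [|s w lw IH] c.
  by apply: (sub_finite_set (B := [set c])) => // d /delta_eq1 ->.
have fin : finite_set [set b | delta c b = gen s].
  apply: (sub_finite_set (B := chambers (res (finset.set1 s) c))) => [b cb|].
    by rewrite chambers_res cb; apply: par_gen; rewrite inE.
  by apply/finite_setP; exists (q s).+1; exact: Xq.
apply: sub_finite_set (bigcup_finite fin (fun b _ => IH b)).
by move=> d /delta_split[b cb bd]; exists b.
Qed.

Lemma chambers_finite I (A : simplex X I) : spherical I -> finite_set (chambers A).
Proof.
move=> sI; have [c Ac] := chambers_nonempty A.
apply: sub_finite_set (bigcup_finite sI (fun w _ => delta_finite c w)) => d Ad.
by exists (delta c d) => //; rewrite -(chambers_delta _ Ac).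
Qed.

(** Each simplex of the sphere is the residue of a chamber at distance [w] from one of the finitely
    many chambers of [A]. *)
Lemma sphere_finite I J (A : simplex X I) w : spherical I ->
  finite_set (sphere (J := J) A w).
Proof.
move=> sI.
have := bigcup_finite (chambers_finite A sI) (fun a _ => delta_finite a w).
move=> /(finite_image (res J)); apply: sub_finite_set => B Bw.
have [_ [a [b [Aa Bb E]]]] := sdist_spec A B.
by exists b; [exists a; rewrite //= E|exact: res_eq].
Qed.

End Regular.
End Building.

(** * Sums and linear spans *)

Section FiniteSums.
Variables (V : nmodType).

Lemma fsum_const (I : choiceType) (A : set I) n (v : V) : A #= `I_n ->
  \sum_(i \in A) v = v *+ n.
Proof.
move=> An; have fA : finite_set A by apply/finite_setP; exists n.
rewrite fsbig_finite // big_const_seq count_predT (card_fset_set An).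
by elim: n {An} => //= n ->; rewrite mulrS.
Qed.

Lemma fsum_pairs (I J : choiceType) (A : set I) (s : I -> set J)
    (g : I -> J -> V) :
  finite_set A -> (forall i, A i -> finite_set (s i)) ->
  \sum_(i \in A) \sum_(j \in s i) g i j =
  \sum_(p \in [set p | A p.1 /\ s p.1 p.2]) g p.1 p.2.
Proof.
move=> fA fs; pose B := \bigcup_(i in A) s i.
have fB : finite_set B by exact: bigcup_finite.
transitivity (\sum_(i \in A) \sum_(j \in B) if j \in s i then g i j else 0).
  apply: eq_fsbigr => i; rewrite inE => Ai.
  by rewrite -fsbig_mkcondr setIidr // => j sij; exists i.
rewrite pair_fsbig //.
have -> : [set p | A p.1 /\ s p.1 p.2] = (A `*` B) `&` [set p | s p.1 p.2].
  apply/seteqP; split=> -[i j] /=; last by case=> -[].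
  by move=> [Ai sij]; split=> //; split=> //; exists i.
rewrite [RHS]fsbig_mkcondr; apply: eq_fsbigr => -[i j] _ /=.
by congr (if _ then _ else _); apply/idP/idP; rewrite !inE.
Qed.

Lemma fsum_fibers (I K : choiceType) (P : set I) (Q : set K) (h : I -> K)
    (f : K -> V) n :
  finite_set P -> finite_set Q -> (forall i, P i -> Q (h i)) ->
  (forall k, Q k -> [set i | P i /\ h i = k] #= `I_n) ->
  \sum_(i \in P) f (h i) = (\sum_(k \in Q) f k) *+ n.
Proof.
move=> fP fQ PQ fib.
transitivity (\sum_(i \in P) \sum_(k \in Q) if k \in [set h i] then f k else 0).
  apply: eq_fsbigr => i; rewrite inE => /PQ Qi.
  by rewrite -fsbig_mkcondr setIidr ?fsbig_set1 // => _ ->.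
rewrite exchange_fsbig // [in RHS]fsbig_finite // -sumrMnl -fsbig_finite //.
apply: eq_fsbigr => k; rewrite inE => Qk.
rewrite -(fsum_const _ (fib k Qk)).
have -> : [set i | P i /\ h i = k] = P `&` [set i | h i = k] by [].
rewrite [RHS]fsbig_mkcondr; apply: eq_fsbigr => i _.
by congr (if _ then _ else _); apply/idP/idP; rewrite !inE /= => ->.
Qed.

(** Common form of the counting arguments below: pairs $(i,j)$ are regrouped by the value $h(j)$,
    every value being taken by the same number $n$ of pairs. *)
Lemma double_count (I J K : choiceType) (A : set I) (s : I -> set J)
    (Q : set K) (h : J -> K) (f : K -> V) n :
  finite_set A -> (forall i, A i -> finite_set (s i)) -> finite_set Q ->
  (forall i j, A i -> s i j -> Q (h j)) ->
  (forall k, Q k ->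
     [set p | [/\ A p.1, s p.1 p.2 & h p.2 = k]] #= `I_n) ->
  \sum_(i \in A) \sum_(j \in s i) f (h j) = (\sum_(k \in Q) f k) *+ n.
Proof.
move=> fA fs fQ range fib.
rewrite (fsum_pairs (fun _ j => f (h j))) //.
apply: (fsum_fibers (h := fun p => h p.2)) => //.
- apply: sub_finite_set (finite_setX fA (bigcup_finite fA fs)) => -[i j] /= [Ai sij].
  by split=> //; exists i.
- by move=> [i j] /= []; exact: range.
- move=> k Qk; rewrite [X in X #= _](_ : _ = [set p | [/\ A p.1, s p.1 p.2 & h p.2 = k]]).
    exact: fib.
  by apply/seteqP; split=> -[i j] /=; [case=> -[]|case].
Qed.

Lemma fsum_linear (F : fieldType) (U : lmodType F) (I : choiceType) (A : set I)
    (a : F) (f g : I -> U) : finite_set A ->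
  \sum_(i \in A) (a *: f i + g i) = a *: \sum_(i \in A) f i + \sum_(i \in A) g i.
Proof. by move=> fA; rewrite !fsbig_finite // big_split /= scaler_sumr. Qed.

End FiniteSums.

Section LinearSpans.
Variable F : fieldType.

Lemma subspaceE (V : lmodType F) (M : set V) : subspace M ->
  [/\ M 0, forall x y, M x -> M y -> M (x + y) & forall a x, M x -> M (a *: x)].
Proof.
move=> [M0 Mlin]; split=> // [x y Mx My|a x Mx].
  by rewrite -[x]scale1r; exact: Mlin.
by rewrite -[_ *: _]addr0; exact: Mlin.
Qed.

Lemma subspace_sum (V : lmodType F) (M : set V) (I : Type) (r : seq I)
    (f : I -> V) : subspace M -> (forall i, M (f i)) -> M (\sum_(i <- r) f i).
Proof.
move=> /subspaceE[M0 MD _] Mf; elim: r => [|i r IH]; first by rewrite big_nil.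
by rewrite big_cons; exact: MD.
Qed.

Lemma lin_span_sub (V : lmodType F) (E : set V) : E `<=` lin_span E.
Proof.
move=> x Ex; exists 1%N, (fun=> 1), (fun=> x); split=> //.
by rewrite big_ord1 scale1r.
Qed.

Lemma lin_span_subspace (V : lmodType F) (E : set V) : subspace (lin_span E).
Proof.
split=> [|a x y [n [b [e [eE ->]]]] [m [c [d [dE ->]]]]].
  by exists 0%N, (fun=> 0), (fun=> 0); rewrite big_ord0; split=> // -[].
exists (n + m)%N, (fun i => match fintype.split i with inl j => a * b j | inr j => c j end),
  (fun i => match fintype.split i with inl j => e j | inr j => d j end); split.
  by move=> i; case: (fintype.split i).
rewrite big_split_ord /= scaler_sumr; congr (_ + _); apply: eq_bigr => i _.
  by rewrite (unsplitK (inl _ i)) scalerA.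
by rewrite (unsplitK (inr _ i)).
Qed.

(** Induction principle for spans: below, properties of [Aspace] and [hecke] are checked on the
    spanning operators only. *)
Lemma lin_span_min (V : lmodType F) (E M : set V) :
  subspace M -> E `<=` M -> lin_span E `<=` M.
Proof.
move=> Msub EM x [n [b [e [eE ->]]]]; apply: subspace_sum => // i.
by have [_ _ +] := subspaceE Msub; apply; exact: EM.
Qed.

Lemma subspace_preimage (V V' : lmodType F) (M : set V') (f : V -> V') :
  linear f -> subspace M -> subspace (f @^-1` M).
Proof.
move=> lf [M0 Mlin]; split=> [|a x y Mx My] /=; last by rewrite lf; exact: Mlin.
by have := lf (-1) 0 0; rewrite scaler0 addr0 scaleN1r addNr => ->.
Qed.

Lemma linear_zero (V V' : lmodType F) (f : V -> V') : linear f -> f 0 = 0.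
Proof. by move=> lf; have := lf (-1) 0 0; rewrite scaler0 addr0 scaleN1r addNr. Qed.

Lemma linear_scale (V V' : lmodType F) (f : V -> V') a x :
  linear f -> f (a *: x) = a *: f x.
Proof. by move=> lf; rewrite -[a *: x]addr0 lf linear_zero // addr0. Qed.

Lemma linear_add (V V' : lmodType F) (f : V -> V') x y :
  linear f -> f (x + y) = f x + f y.
Proof. by move=> lf; rewrite -[x]scale1r lf !scale1r. Qed.

Lemma subspace_linear (V V' : lmodType F) :
  subspace [set f : V -> V' | linear f].
Proof.
split=> [a x y|b f g lf lg a x y].
  by rewrite scaler0 addr0.
rewrite !fctE lf lg !scalerDr !scalerA mulrC.
by rewrite addrACA.
Qed.

End LinearSpans.

(** * Counting chambers *)

Section Counting.
Variables (W : coxeterSystem) (X : building W).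
Local Notation S := (cox_index W).
Local Notation gen := (@cox_gen W).
Local Notation C := (chamber X).
Local Notation delta := (@wdist W X).
Variables (q : S -> nat) (Xq : regular X q).

Lemma card_fsum (T : choiceType) (A : set T) :
  finite_set A -> A #= `I_(\sum_(i \in A) 1%N).
Proof.
move=> /finite_setP[n An]; rewrite (fsum_const _ An).
by rewrite [X in `I_X](_ : _ = n) //; elim: n {An} => // n; rewrite mulrS => ->.
Qed.

Lemma fsum_card (T : choiceType) (A : set T) n :
  A #= `I_n -> \sum_(i \in A) 1%N = n.
Proof.
move=> An; have fA : finite_set A by apply/finite_setP; exists n.
by apply/card_eq_II; apply: card_eq_trans An; rewrite card_eq_sym; exact: card_fsum.
Qed.

Lemma card_sing (T : Type) (A : set T) x : A x -> (forall y, A y -> y = x) ->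
  A #= `I_1.
Proof.
move=> Ax uA; have -> : A = [set x]; last exact: card_set1.
by apply/seteqP; split=> y /= => [/uA|->].
Qed.

Lemma par_set1 s w : parabolic (finset.set1 s) w -> w = 1%g \/ w = gen s.
Proof.
move=> [ws wsI <-]; elim: ws wsI => [|t ws IH] wsI.
  by left; rewrite word_prod_nil.
have /eqP -> : t == s by have := wsI t (mem_head _ _); rewrite inE.
rewrite word_prod_cons; have [|->|->] := IH.
- by move=> r rws; apply: wsI; rewrite inE rws orbT.
- by right; rewrite mulg1.
- by left; rewrite gen_mulK.
Qed.

Lemma panelE s c : chambers (res (finset.set1 s) c) =
  [set c] `|` [set b | delta c b = gen s].
Proof.
apply/seteqP; split=> d /=; rewrite chambers_res.
  by move=> /par_set1 [/delta_eq1 ->|->]; [left|right].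
case=> [->|->]; first by rewrite delta_refl; exact: par1.
by apply: par_gen; rewrite inE.
Qed.

(** This is $T_sT_w=T_{sw}$ for increasing length, written with sums: the intermediate chamber
    exists by [delta_split] and is unique. *)
Lemma fsum_delta_gen (V : nmodType) s w c (f : C -> V) :
  len (gen s * w)%g = (len w).+1 ->
  \sum_(b \in [set b | delta c b = gen s]) \sum_(d \in [set d | delta b d = w]) f d
  = \sum_(d \in [set d | delta c d = (gen s * w)%g]) f d.
Proof.
move=> lw; pose Q := [set d | delta c d = (gen s * w)%g].
rewrite (double_count (h := id) (Q := Q) _ (n := 1)) //=.
- exact: delta_finite Xq c _.
- by move=> b _; exact: delta_finite Xq b w.
- exact: delta_finite Xq c _.
- by move=> b d cb bd; rewrite /Q /= (delta_up cb) bd.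
move=> d cd; have [b cb bd] := delta_split cd.
apply: (card_sing (x := (b, d))) => // -[b' d'] [/= cb' b'd' d'd].
rewrite d'd in b'd' *; congr pair.
(* Two intermediate chambers are equal or $s$-adjacent; in the second case [delta_up] gives $w=sw$,
   against the length hypothesis. *)
have [|E] := wdist_step (buildingP X) b' (delta_gen_sym cb).
  by rewrite cb' gen_mulK => /delta_eq1 ->.
rewrite cb' in E; have := @delta_up _ _ b b' d s E; rewrite b'd' bd => /(_ lw) ws.
by move: lw; rewrite -ws => /n_Sn.
Qed.

Lemma card_delta_gen s c : [set b | delta c b = gen s] #= `I_(q s).
Proof.
have fin := delta_finite Xq c (gen s).
have := fsum_card (Xq (res (finset.set1 s) c)); rewrite panelE.
rewrite fsbigU0 //=; last first.
  by move=> d /= [-> ]; rewrite delta_refl => /esym /gen_neq1.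
rewrite fsbig_set1 => /eqP; rewrite -add1n => /eqP /addnI <-.
exact: card_fsum.
Qed.

(** Stated for every reduced word, so that $q_w$ does not depend on the word picked by [redword]. *)
Lemma card_delta_word ws c : size ws = len (word_prod gen ws) ->
  [set d | delta c d = word_prod gen ws] #= `I_(\prod_(s <- ws) q s)%N.
Proof.
move=> sz; suff <- : \sum_(d \in [set d | delta c d = word_prod gen ws]) 1%N =
    (\prod_(s <- ws) q s)%N by apply/card_fsum/(delta_finite Xq).
elim: ws sz c => [_|s ws IH sz] c.
  rewrite big_nil word_prod_nil; apply: fsum_card.
  by apply: (card_sing (x := c)); [exact: delta_refl|move=> d /delta_eq1].
rewrite word_prod_cons in sz *.
have lx : size ws = len (word_prod gen ws).
  apply/eqP; rewrite eqn_leq len_le andbT -ltnS.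
  by rewrite [X in (X <= _)%N]sz (leq_trans (len_mul _ _)) // len_gen.
rewrite -fsum_delta_gen; last by rewrite -sz -lx.
under eq_fsbigr do rewrite IH //.
rewrite (fsum_const _ (card_delta_gen s c)) big_cons mulnC.
by elim: (q s) => [|n E]; rewrite ?muln0 // mulrS E mulnS.
Qed.

Lemma card_delta w c : [set d | delta c d = w] #= `I_(qword q w).
Proof.
rewrite -{1}(redwordE w); apply: card_delta_word.
by rewrite redwordE.
Qed.

Lemma fsum_parabolic (V : nmodType) I (A : simplex X I) c (f : C -> V) :
  spherical I -> chambers A c ->
  \sum_(w \in parabolic I) \sum_(d \in [set d | delta c d = w]) f d =
  \sum_(d \in chambers A) f d.
Proof.
move=> sI Ac; rewrite (double_count (h := id) (Q := chambers A) _ (n := 1)) //=.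
- by move=> w _; exact: delta_finite Xq c w.
- exact: (chambers_finite Xq A sI).
- by move=> w d wI cd; rewrite (chambers_delta _ Ac) cd.
move=> d Ad; apply: (card_sing (x := (delta c d, d))) => /=.
  by rewrite -(chambers_delta _ Ac).
by move=> [w d'] /= [_ <- ->].
Qed.

Lemma card_chambers I (A : simplex X I) : spherical I ->
  chambers A #= `I_(poincare q I).
Proof.
move=> sI; have [c Ac] := chambers_nonempty A.
rewrite /poincare; suff -> : \sum_(w \in parabolic I) qword q w =
  \sum_(d \in chambers A) 1%N by apply: card_fsum; exact: (chambers_finite Xq A sI).
rewrite -(fsum_parabolic _ sI Ac).
by apply: eq_fsbigr => w _; rewrite (fsum_card (card_delta w c)).
Qed.

Lemma poincare_gt0 I : spherical I -> (0 < poincare q I)%N.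
Proof.
move=> sI; have [c _] := building_nonempty (buildingP X).
have cA := chambers_res_self I c.
rewrite lt0n; apply/eqP => N0.
have := card_chambers (res I c) sI; rewrite N0 II0 card_eq0 => /eqP E.
by rewrite E in cA.
Qed.

(* The first components of these pairs form a residue of type
   [I :&: w J w^-1], and determine the second ones. *)
Lemma card_minrep_pairs I J w (A : simplex X I) (B : simplex X J) :
  spherical I -> sdist A B = w ->
  [set p | [/\ chambers A p.1, delta p.1 p.2 = w & chambers B p.2]]
    #= `I_(poincare q (conj_cap I w J)).
Proof.
move=> sI AB; have [min [a0 [b0 [Aa0 Bb0 E0]]]] := sdist_spec A B.
rewrite AB in min E0.
set K := conj_cap I w J; set P := (X in X #= _).
have KI u : parabolic K u -> parabolic I u by apply: par_sub; exact: conj_cap_sub.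
have sK : spherical K by apply: sub_finite_set sI.
apply: card_eq_trans (card_chambers (res K a0) sK).
(* If $b$ and $b'$ are both at distance $w$ from $a$, then lengths add in $w\,\delta(b,b')=w$, which
   forces $\delta(b,b')=1$. *)
have injP : {in P &, injective fst}.
  move=> [a b] [a' b']; rewrite !inE => -[/= Aa ab Bb] [_ /= a'b' Bb'] E.
  rewrite -E {a' E} in a'b' *; congr pair; apply: delta_eq1; apply: len_eq0.
  have yJ : parabolic J (delta b b') by rewrite -(chambers_delta _ Bb).
  have := minrep_len_r min yJ.
  rewrite -(delta_add ab erefl (minrep_len_r min yJ)) a'b'.
  by rewrite -[X in X = _]addn0 => /addnI.
rewrite card_eq_sym; apply: card_eq_trans (inj_card_eq injP).
suff -> : chambers (res K a0) = fst @` P by [].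
apply/seteqP; split=> [a|_ /= [[a b] [/= Aa ab Bb] <-]]; rewrite chambers_res.
  move=> aK.
  have xK : parabolic K (delta a a0) by exact: par_delta_sym.
  (* With $x=\delta(a,a_0)$, the distance $xw$ from $a$ to $b_0$ is also $wy$; splitting it after
     $w$ yields the required $b$. *)
  have [y yJ E] := par_conj_cap xK.
  have := delta_add erefl E0 (minrep_len_l min (KI _ xK)).
  rewrite E => /delta_split[b ab bb0]; exists (a, b) => //; split => //=.
    by rewrite (chambers_delta _ Aa0); exact: KI.
  by rewrite (chambers_delta _ Bb0) delta_sym bb0; exact: parV.
(* Conversely, the distance from $a$ to $b_0$ is computed through $a_0$ and through $b$; Kilmoyer's
   theorem applies to the resulting $xw=wy$. *)
apply: par_delta_sym; have yJ : parabolic J (delta b b0) by rewrite -(chambers_delta _ Bb).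
have xI : parabolic I (delta a a0) by rewrite -(chambers_delta _ Aa).
apply: (minrep_conj_cap min xI yJ).
rewrite -(delta_add erefl E0 (minrep_len_l min xI)).
by rewrite (delta_add ab erefl (minrep_len_r min yJ)).
Qed.

End Counting.

(** * Averaging operators *)

Section Operators.
Variables (R : realType) (W : coxeterSystem) (X : building W).
Local Notation S := (cox_index W).
Local Notation gen := (@cox_gen W).
Local Notation delta := (@wdist W X).
Variables (q : S -> nat) (Xq : regular X q).
Local Notation F := R[i].
Local Notation V I := (simplex X I -> F^o).
Local Notation VC := (chamber X -> F^o).
Local Notation N I := ((poincare q I)%:R : F).
Local Notation E0 := (finset.set0 : {set S}).
Local Notation Tav := (Tav R X).
Local Notation Thecke := (Thecke R X).
Local Notation hecke := (hecke R X).
Local Notation Aspace := (Aspace R X).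
Local Notation Pop := (Pop R X q).
Local Notation idem := (idem R X q).

(** The operator $T_w$ on functions of actual chambers. [Thecke] acts instead on functions of
    simplices of empty cotype; [TheckeE] translates. *)
Definition tau (w : W) : VC -> VC := fun g c => \sum_(d \in [set d | delta c d = w]) g d.
Definition pull (I : {set S}) : V I -> VC := fun f c => f (res I c).
Definition avg (I : {set S}) : VC -> V I :=
  fun g A => (N I)^-1 *: \sum_(c \in chambers A) g c.
Arguments avg : clear implicits.

Lemma poincare_neq0 I : spherical I -> N I != 0.
Proof. by move=> sI; rewrite Num.Theory.pnatr_eq0 -lt0n (poincare_gt0 Xq). Qed.

Lemma fct_fsumE (T : Type) (U : nmodType) (I : choiceType) (A : set I)
    (f : I -> T -> U) x : finite_set A ->
  (\sum_(i \in A) f i) x = \sum_(i \in A) f i x.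
Proof. by move=> fA; rewrite !fsbig_finite // fct_sumE. Qed.

Lemma fct_scaleE (T : Type) (U : lmodType F) (a : F) (f : T -> U) x :
  (a *: f) x = a *: f x.
Proof. by []. Qed.

Lemma linear_fsum (U U' : lmodType F) (I : choiceType) (A : set I)
    (f : U -> U') (g : I -> U) : linear f -> finite_set A ->
  f (\sum_(i \in A) g i) = \sum_(i \in A) f (g i).
Proof.
move=> lf fA; rewrite !fsbig_finite //; elim: (finmap.enum_fset (fset_set A)) => [|i r IH].
  by rewrite !big_nil linear_zero.
by rewrite !big_cons linear_add // IH.
Qed.

Lemma scale_mulrn (a : F) (v : F^o) n : a *: (v *+ n) = (a * n%:R) *: v.
Proof. by rewrite -scalerMnr scalerMnl mulr_natr. Qed.

Lemma tau_linear w : linear (tau w).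
Proof.
move=> a f g; apply/funext => c.
exact: (fsum_linear a f g (delta_finite Xq c w)).
Qed.

Lemma avg_linear I : spherical I -> linear (avg I).
Proof.
move=> sI a f g; apply/funext => A; rewrite /avg.
rewrite (fsum_linear a f g (chambers_finite Xq A sI)).
by rewrite scalerDr [X in X + _]scalerA mulrC -scalerA.
Qed.

Lemma Tav_linear I J w : spherical I -> linear (Tav I J w).
Proof.
move=> sI a f g; apply/funext => A; rewrite /Defs.Tav.
exact: (fsum_linear a f g (sphere_finite Xq J A w sI)).
Qed.

Lemma avg_pull I (f : V I) : spherical I -> avg I (pull f) = f.
Proof.
move=> sI; apply/funext => A; rewrite /avg.
rewrite (_ : \sum_(c \in _) _ = \sum_(c \in chambers A) f A).
  rewrite (fsum_const _ (card_chambers Xq A sI)) scale_mulrn.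
  by rewrite mulVf ?scale1r // poincare_neq0.
by apply: eq_fsbigr => c; rewrite inE => /res_eq <-.
Qed.

Lemma pull_avg I (g : VC) : spherical I ->
  pull (avg I g) = (N I)^-1 *: \sum_(w \in parabolic I) tau w g.
Proof.
move=> sI; apply/funext => c; rewrite /pull /avg fct_scaleE fct_fsumE //.
by rewrite -(fsum_parabolic Xq _ sI (chambers_res_self I c)).
Qed.

Lemma tau1 g : tau 1%g g = g.
Proof.
apply/funext => c; rewrite /tau (_ : [set d | _] = [set c]) ?fsbig_set1 //.
by apply/seteqP; split=> d /= => [/delta_eq1|->] //; exact: delta_refl.
Qed.

Lemma tau_mul u v g : len (u * v)%g = (len u + len v)%N ->
  tau u (tau v g) = tau (u * v)%g g.
Proof.
elim/len_ind: u => [|s u lu IH]; first by rewrite tau1 mul1g.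
rewrite lu -mulgA => luv.
have luv' : len (u * v)%g = (len u + len v)%N.
  apply/eqP; rewrite eqn_leq len_mul -ltnS -addSn -luv.
  by rewrite (leq_trans (len_mul _ _)) // len_gen.
have tau_gen w h : len (gen s * w)%g = (len w).+1 ->
    tau (gen s * w)%g h = tau (gen s) (tau w h).
  by move=> lw; apply/funext => c; rewrite /tau (fsum_delta_gen Xq).
by rewrite tau_gen // IH // -tau_gen // luv luv' addSn.
Qed.

(** For fixed $d$ in the residue, the chambers $c$ with $\delta(c,d)=a$ are those at distance
    $a^{-1}$ from $d$, whence the inverse. *)
Lemma avg_tau I a g : spherical I -> parabolic I a ->
  avg I (tau a g) = (qword q a^-1%g)%:R *: avg I g.
Proof.
move=> sI aI; apply/funext => A; rewrite fctE /avg /tau.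
rewrite (double_count (h := id) (Q := chambers A) _ (n := qword q a^-1%g)).
- by rewrite scale_mulrn mulrC -scalerA.
- exact: (chambers_finite Xq A sI).
- by move=> c _; exact: delta_finite Xq c a.
- exact: (chambers_finite Xq A sI).
- by move=> c d Ac cd; rewrite (chambers_delta _ Ac) cd.
move=> d Ad; apply: card_eq_trans (card_delta Xq a^-1%g d).
have injp : {in [set c | delta d c = a^-1%g] &, injective (fun c => (c, d))}.
  by move=> c c' _ _ [].
rewrite [X in X #= _](_ : _ = (fun c => (c, d)) @` [set c | delta d c = a^-1%g]).
  exact: inj_card_eq.
apply/seteqP; split=> [[c d'] /= [Ac <- ->]|_ [c /= dc <-]].
  by exists c => //=; rewrite delta_sym.
by split => //=; [rewrite (chambers_delta _ Ad) dc; exact: parV|rewrite delta_sym dc invgK].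
Qed.

Lemma tau_pull J b (f : V J) : parabolic J b ->
  tau b (pull f) = (qword q b)%:R *: pull f.
Proof.
move=> bJ; apply/funext => c; rewrite fctE /tau /pull.
rewrite scaler_nat -(fsum_const _ (card_delta Xq b c)).
apply: eq_fsbigr => d; rewrite inE /= => cd; congr f.
by apply: res_eq; rewrite chambers_res cd.
Qed.

(** By [card_minrep_pairs], each simplex of the sphere is reached by $N(I\cap wJw^{-1})$ pairs of
    chambers; the average divides by $N(I)$. *)
Lemma avg_tau_pull I J w (f : V J) : spherical I -> minrep I J w ->
  avg I (tau w (pull f)) = (N (conj_cap I w J) / N I) *: Tav I J w f.
Proof.
move=> sI min; apply/funext => A; rewrite fctE /avg /tau /pull.
rewrite (double_count (h := res J) (Q := sphere A w) f (n := poincare q (conj_cap I w J))).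
- by rewrite scale_mulrn mulrC.
- exact: (chambers_finite Xq A sI).
- by move=> c _; exact: delta_finite Xq c w.
- exact: (sphere_finite Xq J A w sI).
- move=> a b Aa ab; rewrite /sphere /= -ab; apply: sdist_delta => //.
    exact: chambers_res_self.
  by rewrite ab.
move=> B AB; rewrite [X in X #= _](_ : _ =
    [set p | [/\ chambers A p.1, delta p.1 p.2 = w & chambers B p.2]]).
  exact: card_minrep_pairs.
by apply/seteqP; split=> -[a b] /= [Aa ab /chambersP Bb].
Qed.

Lemma par0 (w : W) : parabolic E0 w -> w = 1%g.
Proof.
move=> [[|s ws] ws0 <-]; first by rewrite word_prod_nil.
by have := ws0 s (mem_head _ _); rewrite inE.
Qed.

Lemma parabolic0 : parabolic E0 = [set 1%g].
Proof. by apply/seteqP; split=> w /= => [/par0|->] //; exact: par1. Qed.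

Lemma spherical0 : spherical E0.
Proof. by rewrite /spherical parabolic0; exact: finite_set1. Qed.

Lemma poincare0 : poincare q E0 = 1%N.
Proof.
rewrite /poincare parabolic0 fsbig_set1 /qword.
suff -> : redword 1%g = [::] :> seq S by rewrite big_nil.
by apply: size0nil; exact: len1.
Qed.

Lemma conj_cap0 w : conj_cap E0 w E0 = E0.
Proof. by apply/finset.setP => s; rewrite !inE. Qed.

Lemma minrep0 w : minrep E0 E0 w.
Proof. by move=> a b /par0 -> /par0 ->; rewrite mul1g mulg1. Qed.

Lemma pull_avg0 g : pull (avg E0 g) = g.
Proof.
rewrite pull_avg; last exact: spherical0.
by rewrite poincare0 parabolic0 fsbig_set1 tau1 invr1 scale1r.
Qed.

Lemma TheckeE w f : Thecke w f = avg E0 (tau w (pull f)).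
Proof.
rewrite avg_tau_pull; [|exact: spherical0|exact: minrep0].
by rewrite conj_cap0 poincare0 divr1 scale1r.
Qed.

Definition infl (I : {set S}) : V I -> V E0 := avg E0 \o @pull I.
Definition defl (I : {set S}) : V E0 -> V I := avg I \o @pull E0.
Arguments defl : clear implicits.

Lemma infl_linear I : linear (@infl I).
Proof. by move=> a f g; rewrite /infl /= -(avg_linear spherical0). Qed.

Lemma defl_linear I : spherical I -> linear (defl I).
Proof. by move=> sI a f g; rewrite /defl /= -(avg_linear sI). Qed.

Lemma defl_avg0 I g : defl I (avg E0 g) = avg I g.
Proof. by rewrite /defl /= pull_avg0. Qed.

Lemma pull_infl I (f : V I) : pull (infl f) = pull f.
Proof. exact: pull_avg0. Qed.

Lemma defl_infl I (f : V I) : spherical I -> defl I (infl f) = f.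
Proof. by move=> sI; rewrite defl_avg0 avg_pull. Qed.

Lemma infl_defl I f : spherical I -> infl (defl I f) = idem I f.
Proof.
move=> sI; rewrite /infl /defl /= pull_avg // /Defs.idem.
rewrite (linear_scale _ _ (avg_linear spherical0)).
rewrite (linear_fsum _ (avg_linear spherical0) sI).
rewrite fct_scaleE fct_fsumE //; congr (_ *: _); apply: eq_fsbigr => w _.
by rewrite TheckeE.
Qed.

(** Both idempotents factor through [defl] and [infl], and [avg_tau_pull] evaluates the middle part
    [defl I \o Thecke w \o infl J]; its scalar cancels the one in [Pop]. *)
Lemma PopE I J w f : spherical I -> spherical J -> minrep I J w ->
  Pop I J w f = infl (Tav I J w (defl J f)).
Proof.
move=> sI sJ min; rewrite /Defs.Pop fct_scaleE /mul_hop /comp_op.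
rewrite -!infl_defl // TheckeE defl_avg0 pull_infl (avg_tau_pull _ sI min).
rewrite (linear_scale _ _ (@infl_linear I)).
rewrite scalerA mulf_div [X in X / _]mulrC divff ?scale1r // mulf_neq0 ?poincare_neq0 //.
by apply: sub_finite_set sI => u; apply: par_sub; exact: conj_cap_sub.
Qed.

(** * Closure of the Hecke algebra and of the spaces [Aspace] under products *)

Lemma Aspace_subspace I J : subspace (Aspace I J).
Proof. exact: lin_span_subspace. Qed.

Lemma Tav_Aspace I J w : minrep I J w -> Aspace I J (Tav I J w).
Proof. by move=> min; apply: lin_span_sub; exists w. Qed.

Lemma Thecke_hecke w : hecke (Thecke w).
Proof. by apply: Tav_Aspace; exact: minrep0. Qed.

Lemma Aspace_linear I J (x : op R X I J) : spherical I -> Aspace I J x -> linear x.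
Proof.
move=> sI; apply: (lin_span_min (subspace_linear _ _)) => _ [w _ <-].
exact: Tav_linear.
Qed.

Lemma hecke_linear (x : hop R X) : hecke x -> linear x.
Proof. exact/Aspace_linear/spherical0. Qed.

(** For $w=amb$ with additive lengths, $T_b$ acts on functions constant on $J$-residues by $q_b$,
    and $T_a$ followed by averaging over $I$-residues contributes $q_{a^{-1}}$. Only the minimal $m$
    remains. *)
Lemma avg_tau_pull_Aspace I J w : spherical I -> spherical J ->
  Aspace I J (fun f => avg I (tau w (pull f))).
Proof.
move=> sI sJ; have [a [m [b [aI min bJ E lenE]]]] := minrep_decomp I J w.
have [_ _ AZ] := subspaceE (Aspace_subspace I J).
rewrite (_ : (fun f => _) = ((qword q b)%:R * (qword q a^-1%g)%:R *
    (N (conj_cap I m J) / N I)) *: (Tav I J m : op R X I J)).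
  by apply: AZ; exact: Tav_Aspace.
apply/funext => f; rewrite fct_scaleE.
have lam : len (a * m)%g = (len a + len m)%N by exact: minrep_len_l min aI.
have -> : tau w (pull f) = (qword q b)%:R *: tau a (tau m (pull f)).
  rewrite E -tau_mul -?E ?lam // tau_pull //.
  by rewrite linear_scale ?tau_mul //; exact: tau_linear.
rewrite (linear_scale _ _ (avg_linear sI)).
by rewrite avg_tau // avg_tau_pull // !scalerA.
Qed.

Lemma defl_hecke_infl I J h : spherical I -> spherical J -> hecke h ->
  Aspace I J (fun f => defl I (h (infl f))).
Proof.
move=> sI sJ; pose conj (h : hop R X) : op R X I J := fun f => defl I (h (infl f)).
have lconj : linear conj by move=> a x y; apply/funext => f; exact: defl_linear.
apply: (lin_span_min (subspace_preimage lconj (Aspace_subspace I J))).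
move=> _ [w _ <-] /=; have := avg_tau_pull_Aspace w sI sJ.
congr (Aspace I J _); apply/funext => f.
by rewrite /conj -/(Thecke w) TheckeE defl_avg0 pull_infl.
Qed.

Lemma Thecke1 h : mul_hop (Thecke 1%g) h = h.
Proof.
by apply/funext => f; rewrite /mul_hop /comp_op TheckeE tau1 avg_pull //; exact: spherical0.
Qed.

Lemma Thecke_mul u v : len (u * v)%g = (len u + len v)%N ->
  mul_hop (Thecke u) (Thecke v) = Thecke (u * v)%g.
Proof.
move=> luv; apply/funext => f; rewrite /mul_hop /comp_op !TheckeE pull_avg0.
by rewrite tau_mul.
Qed.

Lemma hecke_idem I : spherical I -> hecke (idem I).
Proof.
move=> sI; have [_ _ AZ] := subspaceE (Aspace_subspace E0 E0).
apply: AZ; rewrite fsbig_finite //; apply: subspace_sum => [|w].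
  exact: Aspace_subspace.
exact: Thecke_hecke.
Qed.

Lemma idemK I f : spherical I -> idem I (idem I f) = idem I f.
Proof. by move=> sI; rewrite -!infl_defl // defl_infl. Qed.

Lemma spherical_set1 (s : S) : spherical (finset.set1 s).
Proof.
apply: (sub_finite_set (B := [set 1%g] `|` [set gen s])).
  by move=> w /par_set1[->|->]; [left|right].
by rewrite finite_setU; split; exact: finite_set1.
Qed.

(** The idempotent of a panel is $(T_1+T_s)/N(\{s\})$, where $N(\{s\})=q_s+1$; so $T_s$ is expressed
    by an idempotent and the identity. *)
Lemma Thecke_gen s f : Thecke (gen s) f =
  N (finset.set1 s) *: idem (finset.set1 s) f - f.
Proof.
rewrite /Defs.idem fct_scaleE scalerA divff ?poincare_neq0 ?scale1r //;
  last exact: spherical_set1.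
rewrite (_ : parabolic _ = [set 1%g] `|` [set gen s]).
  rewrite fsbigU0 ?fsbig_set1 //; last by move=> w /= [-> /esym/gen_neq1].
  rewrite fctE [X in _ = X + _ - _](_ : _ = f); first by rewrite [f + _]addrC addrK.
  exact: (congr1 (fun h : hop R X => h f) (Thecke1 idfun)).
apply/seteqP; split=> w /=; first by move=> /par_set1[->|->]; [left|right].
by case=> ->; [exact: par1|apply: par_gen; rewrite inE].
Qed.

(* The quadratic relation, from the idempotence of [1 + T_s] up to a scalar. *)
Lemma Thecke_sqr s f : Thecke (gen s) (Thecke (gen s) f) =
  (N (finset.set1 s) - 1) *: f + (N (finset.set1 s) - 1 - 1) *: Thecke (gen s) f.
Proof.
set I := finset.set1 s; have sI : spherical I := @spherical_set1 s.
have lin := hecke_linear (hecke_idem sI).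
rewrite [LHS]Thecke_gen -/I [X in idem I X]Thecke_gen -/I.
rewrite (linear_add _ _ lin) -[- f]scaleN1r.
rewrite (linear_scale _ _ lin) idemK // (linear_scale _ _ lin).
rewrite Thecke_gen -/I scaleN1r.
by apply/funext => A; rewrite !fctE /GRing.scale /=; ring.
Qed.

(** If $s$ lengthens $w$, the product is $T_{sw}$. Otherwise $T_w=T_sT_{sw}$ and the quadratic
    relation applies. *)
Lemma Thecke_gen_mul s y : hecke y -> hecke (mul_hop (Thecke (gen s)) y).
Proof.
have lT : linear (mul_hop (Thecke (gen s))).
  by move=> a x z; apply/funext => f; exact: (Tav_linear _ spherical0).
apply: (lin_span_min (subspace_preimage lT (Aspace_subspace E0 E0))).
move=> _ [w _ <-] /=; rewrite -/(Thecke w).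
have [lw|lw] := len_gen_mul s w.
  by rewrite Thecke_mul ?lw ?len_gen //; exact: Thecke_hecke.
have wE : Thecke w = mul_hop (Thecke (gen s)) (Thecke (gen s * w)%g).
  by rewrite Thecke_mul gen_mulKl // len_gen.
have [_ AD AZ] := subspaceE (Aspace_subspace E0 E0).
rewrite (_ : mul_hop _ _ = (N (finset.set1 s) - 1) *: Thecke (gen s * w)%g +
   (N (finset.set1 s) - 1 - 1) *: Thecke w).
  by apply: AD; apply: AZ; exact: Thecke_hecke.
by apply/funext => f; rewrite wE /mul_hop /comp_op Thecke_sqr.
Qed.

(** Left multiplication by [Thecke u] is reduced, along a reduced word of [u], to left
    multiplication by generators. *)
Lemma hecke_mul x y : hecke x -> hecke y -> hecke (mul_hop x y).
Proof.
move=> Hx; move: x Hx y.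
apply: (lin_span_min (M := [set x | forall y, hecke y -> hecke (mul_hop x y)])).
  have [A0 Alin] := Aspace_subspace E0 E0.
  split=> [y _|a x x' Hx Hx' y Hy]; first exact: A0.
  by apply: Alin; [exact: Hx|exact: Hx'].
move=> _ [u _ <-] /= y Hy; rewrite -/(Thecke u).
elim/len_ind: u => [|s u lu IH]; first by rewrite Thecke1.
rewrite -Thecke_mul ?lu ?len_gen //.
exact: Thecke_gen_mul.
Qed.

(** On a spanning operator [Tav I J w] the result is [Pop I J w], a multiple of a product of
    elements of [hecke]. *)
Lemma infl_Aspace_defl I J x : spherical I -> spherical J -> Aspace I J x ->
  hecke (fun f => infl (x (defl J f))).
Proof.
move=> sI sJ; pose conj (x : op R X I J) : hop R X := fun f => infl (x (defl J f)).
have lconj : linear conj by move=> a y z; apply/funext => f; exact: infl_linear.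
apply: (lin_span_min (subspace_preimage lconj (Aspace_subspace E0 E0))).
move=> _ [w min <-]; rewrite [preimage _ _ _](_ : _ = hecke (Pop I J w)).
  have [_ _ AZ] := subspaceE (Aspace_subspace E0 E0).
  apply: AZ; apply: hecke_mul; last exact: hecke_idem.
  by apply: hecke_mul; [exact: hecke_idem|exact: Thecke_hecke].
by congr hecke; apply/funext => f; rewrite PopE.
Qed.

(** Closure is inherited from [hecke_mul]: [x] and [y] are lifted to [hecke], multiplied there and
    compressed, and the inserted pairs cancel by [defl_infl]. *)
Lemma comp_Aspace I J K (x : op R X I J) (y : op R X J K) :
  spherical I -> spherical J -> spherical K ->
  Aspace I J x -> Aspace J K y -> Aspace I K (comp_op x y).
Proof.
move=> sI sJ sK Ax Ay.
have Hx := infl_Aspace_defl sI sJ Ax; have Hy := infl_Aspace_defl sJ sK Ay.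
have := defl_hecke_infl sI sK (hecke_mul Hx Hy).
congr (Aspace I K _); apply/funext => f.
by rewrite /mul_hop /comp_op !defl_infl.
Qed.

Lemma Aspace_id I : spherical I -> Aspace I I (id_op R X I).
Proof.
move=> sI; have := defl_hecke_infl sI sI (Thecke_hecke 1%g).
congr (Aspace I I _); apply/funext => f.
by rewrite TheckeE tau1 avg_pull ?defl_infl //; exact: spherical0.
Qed.

(** * The isomorphism onto the corner and the module structures *)

Definition theta (I : {set S}) (x : op R X I I) : hop R X :=
  fun f => infl (x (defl I f)).

Lemma theta_linear I : linear (@theta I).
Proof. by move=> a x y; apply/funext => f; exact: infl_linear. Qed.

Lemma corner_subspace I : spherical I -> subspace (corner R X q I).
Proof.
move=> sI; have [H0 Hlin] := Aspace_subspace E0 E0.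
have lin := hecke_linear (hecke_idem sI).
split=> [|a _ _ [h Hh <-] [k Hk <-]].
  by exists 0 => //; apply/funext => f; exact: (linear_zero lin).
exists (a *: h + k); first exact: Hlin.
by apply/funext => f; exact: lin.
Qed.

Lemma corner_idem I h : spherical I -> corner R X q I h ->
  mul_hop (idem I) h = h /\ mul_hop h (idem I) = h.
Proof.
move=> sI [k _ <-]; split; apply/funext => f; rewrite /mul_hop /comp_op.
  by rewrite idemK.
by rewrite [idem I (idem I f)]idemK.
Qed.

Lemma corner_hecke I h : spherical I -> corner R X q I h -> hecke h.
Proof.
move=> sI [k Hk <-]; apply: hecke_mul; last exact: hecke_idem.
by apply: hecke_mul => //; exact: hecke_idem.
Qed.

Lemma corner_mul I h k : spherical I -> corner R X q I h -> corner R X q I k ->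
  corner R X q I (mul_hop h k).
Proof.
move=> sI ch ck; exists (mul_hop h k).
  exact: hecke_mul (corner_hecke sI ch) (corner_hecke sI ck).
have [hl _] := corner_idem sI ch; have [_ kr] := corner_idem sI ck.
by rewrite -[in RHS]hl -[in RHS]kr.
Qed.

Lemma corner_one I : spherical I -> corner R X q I (idem I).
Proof.
move=> sI; exists (idem I); first exact: hecke_idem.
by apply/funext => f; rewrite /mul_hop /comp_op !idemK.
Qed.

Lemma theta_corner I x : spherical I -> Aspace I I x -> corner R X q I (theta x).
Proof.
move=> sI Ax; exists (theta x); first exact: infl_Aspace_defl.
by apply/funext => f; rewrite /mul_hop /comp_op /theta -!infl_defl // !defl_infl.
Qed.

Lemma defl_theta_infl I x f : spherical I -> defl I (@theta I x (infl f)) = x f.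
Proof. by move=> sI; rewrite /theta !defl_infl. Qed.

Lemma theta_defl_infl I h : spherical I -> corner R X q I h ->
  theta (fun f => defl I (h (infl f))) = h.
Proof.
move=> sI ch; have [hl hr] := corner_idem sI ch.
by apply/funext => f; rewrite /theta !infl_defl // -[in RHS]hl -[in RHS]hr.
Qed.

(** Multiplicativity is [defl_infl]. The inverse sends $h$ to [defl I \o h \o infl I], which
    recovers $h$ on the corner because [idem I] is a two-sided identity there. *)
Lemma theta_iso I : spherical I ->
  is_algebra_iso comp_op (id_op R X I) (Aspace I I)
    mul_hop (idem I) (corner R X q I) (@theta I).
Proof.
move=> sI; split.
- split.
  + exact: Aspace_subspace.
  + exact: Aspace_id.
  + by move=> x y; exact: comp_Aspace.
  + by [].
  + by [].
  + by [].
  + move=> x Ax a y z _ _; apply/funext => f.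
    exact: (Aspace_linear sI Ax).
- split.
  + exact: corner_subspace.
  + exact: corner_one.
  + by move=> x y; exact: corner_mul.
  + by [].
  + by move=> x; exact: corner_idem.
  + by [].
  + move=> x cx a y z _ _; apply/funext => f.
    exact: (hecke_linear (corner_hecke sI cx)).
- by move=> a x y _ _; exact: theta_linear.
- split.
  + by move=> x; exact: theta_corner.
  + move=> x y _ _ E; apply/funext => f.
    by rewrite -[LHS](defl_theta_infl _ _ sI) E defl_theta_infl.
  + move=> h ch; exists (fun f => defl I (h (infl f))).
      exact/defl_hecke_infl/(corner_hecke sI ch).
    exact: theta_defl_infl.
- by move=> x y _ _; apply/funext => f; rewrite /mul_hop /comp_op /theta defl_infl.
- by apply/funext => f; rewrite /theta infl_defl.
Qed.

Lemma theta_Tav I w : spherical I -> minrep I I w -> theta (Tav I I w) = Pop I I w.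
Proof. by move=> sI min; apply/funext => f; rewrite PopE. Qed.

Lemma left_module I J : spherical I -> spherical J ->
  exists lact : hop R X -> op R X I J -> op R X I J,
    is_left_module mul_hop (idem I) (corner R X q I) (Aspace I J) lact /\
    (forall x t, Aspace I I x -> Aspace I J t -> lact (theta x) t = comp_op x t).
Proof.
(* The action composes the preimage of [h] under [theta] with [t]. *)
move=> sI sJ; exists (fun h t f => defl I (h (infl (t f)))); split; last first.
  by move=> x t _ _; apply/funext => f; rewrite defl_theta_infl.
split.
- exact: Aspace_subspace.
- move=> h t /(corner_hecke sI) Hh At.
  exact: (comp_Aspace sI sI sJ (defl_hecke_infl sI sI Hh) At).
- by move=> t _ a h k _ _; apply/funext => f; exact: (defl_linear sI).
- move=> h /(corner_hecke sI)/hecke_linear lh a t t' _ _; apply/funext => f.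
  by rewrite [(a *: t + t') f]fctE (@infl_linear I) lh (defl_linear sI).
- move=> h k t ch ck _; apply/funext => f; rewrite infl_defl //.
  by rewrite -[in LHS](corner_idem sI ck).1.
- by move=> t _; apply/funext => f; rewrite -infl_defl // !defl_infl.
Qed.

Lemma right_module I J : spherical I -> spherical J ->
  exists ract : op R X I J -> hop R X -> op R X I J,
    is_right_module mul_hop (idem J) (corner R X q J) (Aspace I J) ract /\
    (forall t y, Aspace I J t -> Aspace J J y -> ract t (theta y) = comp_op t y).
Proof.
move=> sI sJ; exists (fun t h f => t (defl J (h (infl f)))); split; last first.
  by move=> t y _ _; apply/funext => f; rewrite defl_theta_infl.
split.
- exact: Aspace_subspace.
- move=> h t /(corner_hecke sJ) Hh At.
  exact: (comp_Aspace sI sJ sJ At (defl_hecke_infl sJ sJ Hh)).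
- move=> t At a h k _ _; apply/funext => f.
  by rewrite [(a *: h + k) _]fctE (defl_linear sJ) (Aspace_linear sI At).
- by [].
- move=> h k t ch ck _; apply/funext => f; rewrite infl_defl //.
  by rewrite -[in LHS](corner_idem sJ ch).1.
- by move=> t _; apply/funext => f; rewrite -infl_defl // !defl_infl.
Qed.

(** * Structure constants *)

Lemma Aspace_coef I J (x : op R X I J) : Aspace I J x ->
  exists (D : seq W) (c : W -> F),
    [/\ uniq D, forall w, w \in D -> minrep I J w
      & x = \sum_(w <- D) c w *: (Tav I J w : op R X I J)].
Proof.
move=> [n [a [e [eE ->]]]].
have /choice[v vE] i : exists w, minrep I J w /\ e i = Tav I J w.
  by have [w min <-] := eE i; exists w.
(* Repeated indices are merged, so that evaluating at an indicator function isolates a single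
   coefficient. *)
pose D := undup [seq v i | i <- enum 'I_n].
exists D, (fun w => \sum_(i | v i == w) a i); split.
- exact: undup_uniq.
- by move=> w; rewrite mem_undup => /mapP[i _ ->]; case: (vE i).
under [RHS]eq_bigr do rewrite scaler_suml big_mkcond /=.
rewrite exchange_big /=; apply: eq_bigr => i _.
have viD : v i \in D by rewrite mem_undup map_f // mem_enum.
rewrite (bigD1_seq (v i)) ?undup_uniq //= eqxx (vE i).2 big1 ?addr0 // => w.
by rewrite eq_sym => /negbTE ->.
Qed.

Definition indicator (K : {set S}) (B : simplex X K) : V K := fun B' => (B' == B)%:R.

Lemma Tav_ind I K w (A : simplex X I) (B : simplex X K) :
  Tav I K w (indicator B) A = (sdist A B == w)%:R.
Proof.
rewrite /Defs.Tav /indicator.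
have [AB|AB] := eqVneq (sdist A B) w.
  rewrite -(fsbig_widen [set B]) ?fsbig_set1 ?eqxx //.
    by move=> _ ->.
  by move=> B' [_ /= /eqP/negbTE ->].
apply: fsbig1 => B' /= AB'; case: eqP => // E.
by rewrite -AB' E eqxx in AB.
Qed.

(** The value counts the $C$ with $\delta(A,C)=u$ and $\delta(C,B)=v$. Seen from $B$ the latter is
    $\delta(B,C)=v^{-1}$, which explains the inverse in the structure constants. *)
Lemma Tav_mul_ind I J K u v (A : simplex X I) (B : simplex X K) n :
  spherical I ->
  sphere (J := J) A u `&` sphere (J := J) B v^-1%g #= `I_n ->
  Tav I J u (Tav J K v (indicator B)) A = n%:R.
Proof.
move=> sI cn; rewrite -[n%:R](fsum_const _ cn) fsbig_mkcondr.
rewrite {1}/Defs.Tav; apply: eq_fsbigr => C _; rewrite Tav_ind.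
suff -> : (C \in sphere B v^-1%g) = (sdist C B == v) by case: eqP.
apply/idP/eqP; rewrite inE /sphere /= (sdistV C B); last by move=> ->.
by move=> /(congr1 (fun w => w^-1%g)); rewrite !invgK.
Qed.

Lemma comp_Tav_coef I J K u v : spherical I -> spherical J -> spherical K ->
  minrep I J u -> minrep J K v ->
  exists D : seq W, [/\ uniq D, forall w, w \in D -> minrep I K w,
    forall w, minrep I K w -> w \notin D -> cnum X I J K u v^-1%g w = 0%N
    & comp_op (Tav I J u) (Tav J K v) =
      \sum_(w <- D) (cnum X I J K u v^-1%g w)%:R *: (Tav I K w : op R X I K)].
Proof.
move=> sI sJ sK minu minv.
have [D [c [uD minD xE]]] :=
  Aspace_coef (comp_Aspace sI sJ sK (Tav_Aspace minu) (Tav_Aspace minv)).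
pose k w := if w \in D then c w else 0.
have cardE (A : simplex X I) (B : simplex X K) n :
    sphere (J := J) A u `&` sphere (J := J) B v^-1%g #= `I_n -> n%:R = k (sdist A B).
  move=> /(Tav_mul_ind sI) <-.
  rewrite -[LHS]/(comp_op (Tav I J u) (Tav J K v) (indicator B) A).
  rewrite xE !fct_sumE (eq_bigr (fun w => if w == sdist A B then c w else 0)); last first.
    move=> w _; rewrite !fct_scaleE Tav_ind eq_sym.
    by case: eqP => _; rewrite /GRing.scale /= ?mulr1 ?mulr0.
  rewrite /k; case: ifPn => [wD|wD].
    rewrite (bigD1_seq (sdist A B)) //= eqxx big1 ?addr0 // => w /negbTE -> //.
  rewrite big1_seq // => w /= wD'; case: eqP => // E.
  by rewrite -E wD' in wD.
have cnumE w : minrep I K w -> (cnum X I J K u v^-1%g w)%:R = k w.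
  (* A pair at distance [w] exists, so the condition defining [cnum] is not vacuous and fixes the
     number. *)
  move=> /(@sdist_onto W X)[A [B AB]].
  have [n cn] : exists n, sphere (J := J) A u `&` sphere (J := J) B v^-1%g #= `I_n.
    by apply/finite_setP/finite_setIl/(sphere_finite Xq J A u sI).
  have nP (A' : simplex X I) (B' : simplex X K) : sdist A' B' = w ->
      sphere (J := J) A' u `&` sphere (J := J) B' v^-1%g #= `I_n.
    move=> AB'.
    have [m cm] : exists m, sphere (J := J) A' u `&` sphere (J := J) B' v^-1%g #= `I_m.
      by apply/finite_setP/finite_setIl/(sphere_finite Xq J A' u sI).
    (* Both counts map to [k w] in a field of characteristic zero, hence agree; so [cnum] is a
       genuine count and not the default [0]. *)
    suff -> : n = m by [].
    by apply/eqP; rewrite -(Num.Theory.eqr_nat F) (cardE _ _ _ cn) (cardE _ _ _ cm) AB AB'.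
  rewrite -[in RHS]AB; apply: (cardE A B); rewrite /cnum.
  by case: xgetP => [m _ cm|/(_ n)]; [exact: cm|case].
exists D; split=> //.
  move=> w minw wD; apply/eqP; rewrite -(Num.Theory.pnatr_eq0 F) cnumE //.
  by rewrite /k (negbTE wD).
rewrite xE; apply: eq_big_seq => w wD.
by rewrite cnumE ?/k ?wD //; exact: minD.
Qed.

Lemma Pop_mul I J K u v : spherical I -> spherical J -> spherical K ->
  minrep I J u -> minrep J K v ->
  mul_hop (Pop I J u) (Pop J K v) =
    \sum_(w \in minrep I K) (cnum X I J K u v^-1%g w)%:R *: Pop I K w.
Proof.
move=> sI sJ sK minu minv.
have [D [uD minD D0 xE]] := comp_Tav_coef sI sJ sK minu minv.
(* The set $R(I,K)$ may be infinite, but the coefficients vanish outside the finite list [D]. *)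
rewrite (fsbigE D) //; last by move=> w minw wD; rewrite D0 // scale0r.
rewrite big_seq_cond (eq_bigl (fun w => w \in D)); last first.
  by move=> w; case: (boolP (w \in D)) => //= /minD /mem_set ->.
rewrite -big_seq; apply/funext => f.
rewrite /mul_hop /comp_op !PopE // defl_infl //.
rewrite -[Tav I J u (Tav J K v _)]/(comp_op (Tav I J u) (Tav J K v) (defl K f)).
rewrite xE [LHS](_ : _ = \sum_(w <- D)
    infl (((cnum X I J K u v^-1%g w)%:R *: (Tav I K w : op R X I K)) (defl K f))).
  rewrite [in RHS]fct_sumE; apply: eq_big_seq => w wD.
  by rewrite !fct_scaleE (linear_scale _ _ (@infl_linear I)) PopE //; exact: minD.
elim: (D) => [|w r IH]; first by rewrite !big_nil (linear_zero (@infl_linear I)).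
by rewrite !big_cons -IH -(linear_add _ _ (@infl_linear I)).
Qed.

End Operators.

Theorem theorem4p9 (R : realType) (W : coxeterSystem) (X : building W)
    (q : cox_index W -> nat) (Xq : regular X q) :
  (forall I J K : {set cox_index W},
     spherical I -> spherical J -> spherical K ->
     forall u v : W, minrep I J u -> minrep J K v ->
     mul_hop (Pop R X q I J u) (Pop R X q J K v) =
       \sum_(w \in minrep I K) (cnum X I J K u v^-1%g w)%:R *: Pop R X q I K w) /\
  (exists theta : forall I : {set cox_index W}, op R X I I -> hop R X,
     (forall I : {set cox_index W}, spherical I ->
        [/\ linear_on (Aspace R X I I) (theta I),
            forall w, minrep I I w -> theta I (Tav R X I I w) = Pop R X q I I w
          & is_algebra_iso
              comp_op (id_op R X I) (Aspace R X I I)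
              mul_hop (idem R X q I) (corner R X q I)
              (theta I)]) /\
     (forall I J : {set cox_index W}, spherical I -> spherical J ->
        (exists lact : hop R X -> op R X I J -> op R X I J,
           is_left_module mul_hop (idem R X q I) (corner R X q I)
             (Aspace R X I J) lact /\
           (forall x t, Aspace R X I I x -> Aspace R X I J t ->
              lact (theta I x) t = comp_op x t)) /\
        (exists ract : op R X I J -> hop R X -> op R X I J,
           is_right_module mul_hop (idem R X q J) (corner R X q J)
             (Aspace R X I J) ract /\
           (forall t y, Aspace R X I J t -> Aspace R X J J y ->
              ract t (theta J y) = comp_op t y)))).
Proof.
split=> [I J K sI sJ sK u v|]; first exact: Pop_mul.
exists (fun I x => theta q x); split=> [I sI|I J sI sJ].
  split; last exact: theta_iso.
    by move=> a x y _ _; exact: theta_linear.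
  by move=> w; exact: theta_Tav.
by split; [exact: left_module|exact: right_module].
Qed.
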